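(* Let $(M,g)$ be a Riemannian manifold. Let $f_{1}, f_{2}:M\to\mathbb{R}$ be such that $f_{1}$ is lower semicontinuous and $f_{2}$ is uniformly continuous. Take $p\in M$, a chart $(U,\varphi)$ with $p\in U$, $\zeta\in D^{-}(f_{1}+f_{2})(p)$, $\varepsilon>0$, and a neighborhood $V$ of $(p,\zeta)$ in the cotangent bundle $T^{*}M$. Then there exist $p_{1}, p_{2}\in U$, $\zeta_{1}\in D^{-}f_{1}(p_{1})$, $\zeta_{2}\in D^{-}f_{2}(p_{2})$ such that $$\big(p_{i},\ \zeta_{1}\circ d\varphi(p_1)^{-1}\circ d\varphi(p_i)+\zeta_{2}\circ d\varphi(p_2)^{-1}\circ d\varphi(p_i)\big)\in V\quad\text{for } i=1,2,$$ and $|f_{i}(p_{i})-f_{i}(p)|<\varepsilon$ for $i=1,2$.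
   Context: A Riemannian manifold is a $C^\infty$ manifold modelled on a Hilbert space $H$ (possibly infinite-dimensional) with a $C^\infty$ assignment of scalar products on the tangent spaces inducing equivalent norms; uniform continuity is with respect to the Riemannian distance $d$. A chart $\varphi:U\to H$ belongs to the $C^\infty$ structure, and $d\varphi(q):TM_q\to H$ is its differential. For $f:M\to\mathbb{R}$ and $p\in M$, the subdifferential $D^{-}f(p)\subset T^*M_p$ is the set of all $d\psi(p)$ with $\psi\in C^1(M,\mathbb{R})$ such that $f-\psi$ attains a local minimum at $p$. *)

(* Defs.v *)
From HB Require Import structures.
From mathcomp Require Import all_boot all_order all_algebra.
From mathcomp Require Import all_classical all_reals all_analysis.

Set Implicit Arguments.
Unset Strict Implicit.
Unset Printing Implicit Defensive.

Import Order.TTheory GRing.Theory Num.Theory.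
Import numFieldNormedType.Exports.

Local Open Scope classical_set_scope.
Local Open Scope ring_scope.

Section BoundedOperators.
Context {R : realType} {V W : normedModType R}.

Definition continuous_linear : {pred V -> W} :=
  fun f => `[< linear f /\ continuous f >].

Record bop := Bop { bop_fun :> V -> W ; _ : bop_fun \in continuous_linear }.

HB.instance Definition _ := [isSub for bop_fun].
HB.instance Definition _ := [Choice of bop by <:].

Lemma bop_linear (f : bop) : linear f.
Proof. by case: f => f /= /asboolP[]. Qed.

Lemma bop_continuous (f : bop) : continuous f.
Proof. by case: f => f /= /asboolP[]. Qed.

HB.instance Definition _ (f : bop) :=
  GRing.isLinear.Build R V W _ f (bop_linear f).

Lemma continuous_linear_submod : submod_closed continuous_linear.
Proof.
split.
  apply/asboolP; split; last exact: cst_continuous.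
  by move=> a u v /=; rewrite scaler0 addr0.
move=> a f h /asboolP[lf cf] /asboolP[lh ch]; apply/asboolP; split.
  have E x : (a *: f + h) x = a *: f x + h x by [].
  move=> b u v; rewrite !E lf lh.
  by rewrite !scalerDr !scalerA (mulrC a b) addrACA.
move=> x; apply: continuousD; last exact: ch.
by apply: continuousZr; exact: cf.
Qed.

HB.instance Definition _ := GRing.isSubmodClosed.Build R (V -> W)
  continuous_linear continuous_linear_submod.
HB.instance Definition _ := [SubChoice_isSubLmodule of bop by <:].

Definition unit_values (f : bop) : set R :=
  [set `|f x| | x in [set x | `|x| <= 1]].

Definition opnorm (f : bop) : R := sup (unit_values f).

Lemma unit_values_sup (f : bop) : has_sup (unit_values f).
Proof.
split; first by exists `|f 0|; exists 0; rewrite //= normr0.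
have /linear_bounded_continuous/linear_boundedP : continuous f.
  exact: bop_continuous.
move=> /pinfty_ex_gt0[M M0 fM].
exists M => _ [x /= x1 <-]; apply: le_trans (fM x) _.
by rewrite ler_piMr // ltW.
Qed.

Lemma opnorm_bound (f : bop) x : `|f x| <= opnorm f * `|x|.
Proof.
have [->|x0] := eqVneq x 0; first by rewrite linear0 !normr0 mulr0.
rewrite -ler_pdivrMr ?normr_gt0 //.
apply: (sup_upper_bound (unit_values_sup f)).
exists (`|x|^-1 *: x); rewrite /= ?linearZ /= normrZ normfV normr_id.
  by rewrite mulVf ?normr_eq0.
by rewrite mulrC.
Qed.

Lemma opnorm_le (f : bop) (M : R) :
  (forall x, `|x| <= 1 -> `|f x| <= M) -> opnorm f <= M.
Proof.
move=> fM; apply: ge_sup; first by case: (unit_values_sup f).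
by move=> _ [x /= x1 <-]; exact: fM.
Qed.

Lemma opnorm_ge0 (f : bop) : 0 <= opnorm f.
Proof.
apply: (sup_upper_bound (unit_values_sup f)); exists 0 => /=.
  by rewrite normr0.
by rewrite linear0 normr0.
Qed.

Lemma opnormD (f h : bop) : opnorm (f + h) <= opnorm f + opnorm h.
Proof.
apply: opnorm_le => x x1; have -> : (f + h) x = f x + h x by [].
apply: le_trans (ler_normD _ _) (lerD _ _);
  by apply: le_trans (opnorm_bound _ _) _; rewrite ler_piMr ?opnorm_ge0.
Qed.

Lemma opnormZ_le (a : R) (f : bop) : opnorm (a *: f) <= `|a| * opnorm f.
Proof.
apply: opnorm_le => x x1; have -> : (a *: f) x = a *: f x by [].
rewrite normrZ ler_wpM2l //; apply: le_trans (opnorm_bound _ _) _.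
by rewrite ler_piMr ?opnorm_ge0.
Qed.

Lemma opnormZ (a : R) (f : bop) : opnorm (a *: f) = `|a| * opnorm f.
Proof.
apply/eqP; rewrite eq_le opnormZ_le /=.
have [->|a0] := eqVneq a 0; first by rewrite normr0 mul0r opnorm_ge0.
rewrite -ler_pdivlMl ?normr_gt0 // -normfV.
by apply: le_trans (opnormZ_le _ _); rewrite scalerA mulVf // scale1r.
Qed.

Lemma opnorm0_eq0 (f : bop) : opnorm f = 0 -> f = 0.
Proof.
move=> f0; apply/val_inj/funext => x /=; apply/eqP; rewrite -normr_le0.
by apply: le_trans (opnorm_bound f x) _; rewrite f0 mul0r.
Qed.

HB.instance Definition _ :=
  Lmodule_isNormed.Build R bop opnormD opnormZ opnorm0_eq0.
End BoundedOperators.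
Arguments bop {R} V W.

(* Frechet C^k regularity on an open set A, the derivatives being continuous for
   the operator norms. *)
Fixpoint Ck {R : realType} (k : nat) {V W : normedModType R} (A : set V)
    (f : V -> W) : Prop :=
  if k is k'.+1 then
    exists2 Df : V -> bop V W,
      forall x, A x -> is_diff x f (Df x) & Ck k' A Df
  else forall x, A x -> {for x, continuous f}.

Lemma near_eq_diff {R : realType} {V W : normedModType R} (f h : V -> W) a v :
  (\near a, f a = h a) -> differentiable f a -> differentiable h a ->
  'd f a v = 'd h a v.
Proof.
move=> fh df dh; rewrite -(deriveE v df) -(deriveE v dh).
exact: near_eq_derive.
Qed.

Definition smooth {R : realType} {V W : normedModType R} (A : set V)
    (f : V -> W) : Prop := forall k, Ck k A f.

Section Manifold.
Context {R : realType} {M : topologicalType} {H : normedModType R}.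

(* The functions chart_fun and chart_inv only matter on the
   domain U and on the range chart_fun(U) respectively. *)
Record chart := Chart {
  chart_dom : set M ;
  chart_fun :> M -> H ;
  chart_inv : H -> M ;
  chart_dom_open : open chart_dom ;
  chart_rng_open : open (chart_fun @` chart_dom) ;
  chart_funK : forall q, chart_dom q -> chart_inv (chart_fun q) = q ;
  chart_fun_continuous :
    forall q, chart_dom q -> {for q, continuous chart_fun} ;
  chart_inv_continuous :
    forall x, (chart_fun @` chart_dom) x -> {for x, continuous chart_inv} }.

Definition chart_rng (c : chart) : set H := c @` chart_dom c.

Definition smooth_transition (c c' : chart) : Prop :=
  smooth (c @` (chart_dom c `&` chart_dom c')) (c' \o chart_inv c).

(* A C^oo structure is a maximal C^oo atlas. *)
Record smooth_structure := SmoothStructure {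
  atlas : set chart ;
  atlas_cover : forall p, exists2 c, atlas c & chart_dom c p ;
  atlas_transition :
    forall c c', atlas c -> atlas c' -> smooth_transition c c' ;
  atlas_maximal : forall c,
    (forall c', atlas c' -> smooth_transition c c' /\ smooth_transition c' c) ->
    atlas c }.

Variable S : smooth_structure.

Definition chart_at (p : M) (c : chart) : Prop := atlas S c /\ chart_dom c p.

Lemma is_diff_transition p c c' : chart_at p c -> chart_at p c' ->
  differentiable (c' \o chart_inv c) (c p).
Proof.
move=> [Sc cp] [Sc' c'p].
have [Df DfE _] := atlas_transition Sc Sc' 1%N.
by have [] := DfE (c p) (ex_intro2 _ _ p (conj cp c'p) erefl).
Qed.

Lemma diff_transition_comp p c c' c'' w :
  chart_at p c -> chart_at p c' -> chart_at p c'' ->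
  'd (c'' \o chart_inv c') (c' p) ('d (c' \o chart_inv c) (c p) w) =
  'd (c'' \o chart_inv c) (c p) w.
Proof.
move=> pc pc' pc''.
have [_ cp] := pc; have [_ c'p] := pc'.
have E : (c' \o chart_inv c) (c p) = c' p by rewrite /= chart_funK.
have d1 := is_diff_transition pc pc'.
have d2 : differentiable (c'' \o chart_inv c') ((c' \o chart_inv c) (c p)).
  by rewrite E; exact: is_diff_transition.
have G y v : y = c' p ->
  'd (c'' \o chart_inv c') y v = 'd (c'' \o chart_inv c') (c' p) v by move->.
apply: etrans (esym (G _ _ E)) _.
apply: etrans (esym (congr1 (fun h => h w) (diff_comp d1 d2))) _.
apply: near_eq_diff; last 2 first.
- exact: differentiable_comp.
- exact: is_diff_transition.
have /open_nbhs_nbhs : open_nbhs (c p) (chart_rng c).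
  by split; [exact: chart_rng_open | exists p].
have : nbhs (c p) (chart_inv c @^-1` chart_dom c').
  apply: chart_inv_continuous; first by exists p.
  by rewrite chart_funK //; apply: open_nbhs_nbhs; split=> //; exact: chart_dom_open.
apply: filterS2 => x /= c'x _.
by rewrite chart_funK.
Qed.

(* Tangent vectors at p are represented by their coordinates in all the charts at
   p; the coordinates are set to 0 in the other charts. *)
Definition tangent_family (p : M) : {pred chart -> H} := fun v =>
  `[< (forall c c', chart_at p c -> chart_at p c' ->
         v c' = 'd (c' \o chart_inv c) (c p) (v c)) /\
      (forall c, ~ chart_at p c -> v c = 0) >].

Record tangent (p : M) := Tangent {
  coordinates : chart -> H ; _ : coordinates \in tangent_family p }.

HB.instance Definition _ := gen_eqMixin chart.
HB.instance Definition _ := gen_choiceMixin chart.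

Section TangentSpace.
Variable p : M.

HB.instance Definition _ := [isSub for @coordinates p].
HB.instance Definition _ := [Choice of tangent p by <:].

Lemma tangent_family_submod : submod_closed (tangent_family p).
Proof.
split; first by apply/asboolP; split=> // c c' pc pc'; rewrite linear0.
move=> a u v /asboolP[u1 u0] /asboolP[v1 v0]; apply/asboolP.
have E c : (a *: u + v) c = a *: u c + v c by [].
split=> [c c' pc pc'|c Npc]; rewrite !E.
  by rewrite linearP (u1 c c') ?(v1 c c').
by rewrite u0 // v0 // scaler0 addr0.
Qed.

HB.instance Definition _ := GRing.isSubmodClosed.Build R (chart -> H)
  (tangent_family p) tangent_family_submod.
HB.instance Definition _ := [SubChoice_isSubLmodule of tangent p by <:].

(* The differential dc(p) : T_pM -> H of a chart c at p. *)
Definition dchart (c : chart) (v : tangent p) : H := coordinates v c.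

Fact dchart_linear c : linear (dchart c). Proof. by []. Qed.
HB.instance Definition _ c :=
  GRing.isLinear.Build R (tangent p) H _ (dchart c) (dchart_linear c).

(* The inverse dc(p)^-1; it is 0 when c is not a chart at p. *)
Definition dchart_inv_family (c : chart) (w : H) (c' : chart) : H :=
  if `[< chart_at p c /\ chart_at p c' >] then
    'd (c' \o chart_inv c) (c p) w
  else 0.

Fact dchart_inv_subproof c w : dchart_inv_family c w \in tangent_family p.
Proof.
apply/asboolP; rewrite /dchart_inv_family; split=> [c1 c2 pc1 pc2|c1 Npc1].
  case: asboolP => [[pc _]|Npc].
    rewrite asboolT // diff_transition_comp //.
  by rewrite asboolF ?linear0 // => -[pc _]; apply: Npc.
by rewrite asboolF // => -[].
Qed.

Definition dchart_inv c w : tangent p := Tangent (dchart_inv_subproof c w).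

Fact dchart_inv_linear c : linear (dchart_inv c).
Proof.
move=> a u v; apply/val_inj/funext => c'.
have E (x y : tangent p) : val (a *: x + y) c' =
  a *: coordinates x c' + coordinates y c' by [].
rewrite E /= /dchart_inv_family; case: asboolP => _; first by rewrite linearP.
by rewrite scaler0 addr0.
Qed.
HB.instance Definition _ c :=
  GRing.isLinear.Build R H (tangent p) _ (dchart_inv c) (dchart_inv_linear c).

Lemma dchart_invE c c' w : chart_at p c -> chart_at p c' ->
  dchart c' (dchart_inv c w) = 'd (c' \o chart_inv c) (c p) w.
Proof. by move=> pc pc'; rewrite /dchart /= /dchart_inv_family asboolT. Qed.

Lemma dchartK c : chart_at p c -> cancel (dchart c) (dchart_inv c).
Proof.
move=> pc [v vP]; apply/val_inj/funext => c' /=.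
have /asboolP[v1 v0] := vP.
rewrite /dchart_inv_family /dchart /=; case: asboolP => [[_ pc']|N].
  by rewrite -v1.
by rewrite v0 // => pc'; apply: N.
Qed.

Lemma dchart_invK c : chart_at p c -> cancel (dchart_inv c) (dchart c).
Proof.
move=> pc w; rewrite dchart_invE //.
have idE : 'd (@id H) (c p) w = w by rewrite diff_val.
rewrite -[RHS]idE.
apply: near_eq_diff => //; last exact: is_diff_transition.
have /open_nbhs_nbhs : open_nbhs (c p) (chart_rng c).
  by split; [exact: chart_rng_open | exists p => //; case: pc].
apply: filterS => x /= [q cq <-].
by rewrite chart_funK.
Qed.

Lemma continuous_dchart_inv c c' : continuous (dchart c' \o dchart_inv c).
Proof.
rewrite /comp /dchart /= /dchart_inv_family.
case: asboolP => [[pc pc']|_]; last exact: cst_continuous.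
exact/diff_continuous/is_diff_transition.
Qed.

End TangentSpace.

(* Continuous linear forms on T_pM, which carries the topology of H through the
   isomorphisms dc(p). *)
Definition cotangent_form (p : M) : {pred tangent p -> R^o} := fun z =>
  `[< linear z /\
      forall c, chart_at p c -> continuous (z \o @dchart_inv p c) >].

Record cotangent (p : M) := Cotangent {
  covector :> tangent p -> R^o ; _ : covector \in @cotangent_form p }.

Section CotangentSpace.
Variable p : M.

HB.instance Definition _ := [isSub for @covector p].
HB.instance Definition _ := [Choice of cotangent p by <:].

Lemma cotangent_form_submod : submod_closed (@cotangent_form p).
Proof.
split.
  apply/asboolP; split=> [a u v|c _]; first by rewrite /= scaler0 addr0.
  exact: cst_continuous.
move=> a y z /asboolP[ly cy] /asboolP[lz cz]; apply/asboolP; split.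
  have E u : (a *: y + z) u = a *: y u + z u by [].
  move=> b u v; rewrite !E ly lz.
  by rewrite !scalerDr !scalerA (mulrC a b) addrACA.
move=> c pc x.
apply: (@continuousD _ _ _ (a *: (y \o @dchart_inv p c)) (z \o @dchart_inv p c)).
  by apply: continuousZr; exact: cy.
exact: cz.
Qed.

HB.instance Definition _ := GRing.isSubmodClosed.Build R (tangent p -> R^o)
  (@cotangent_form p) cotangent_form_submod.
HB.instance Definition _ := [SubChoice_isSubLmodule of cotangent p by <:].

(* z o dc(p)^-1 *)
Fact comp_dchart_inv_subproof (c : chart) (z : cotangent p) :
  (z \o @dchart_inv p c : H -> R^o) \in continuous_linear.
Proof.
case: z => z /= /asboolP[lz cz]; apply/asboolP; split.
  by move=> a u v; rewrite /= linearP lz.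
have [pc|Npc] := pselect (chart_at p c); first exact: cz.
have z0 : z 0 = 0.
  by have := lz (-1) 0 0; rewrite scaler0 addr0 scaleN1r addNr.
rewrite (_ : _ \o _ = cst 0); first exact: cst_continuous.
apply/funext => w /=; rewrite -[RHS]z0; congr z; apply/val_inj/funext => c' /=.
by rewrite /dchart_inv_family asboolF // => -[].
Qed.
Definition comp_dchart_inv c z : bop H R^o := Bop (comp_dchart_inv_subproof c z).

(* l o dc(p) *)
Fact comp_dchart_subproof (c : chart) (l : bop H R^o) :
  (l \o @dchart p c : tangent p -> R^o) \in @cotangent_form p.
Proof.
apply/asboolP; split=> [a u v|c' pc' x]; first by rewrite /= !linearP.
apply: (@continuous_comp _ _ _ (@dchart p c \o @dchart_inv p c') l).
  exact: continuous_dchart_inv.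
exact: bop_continuous.
Qed.
Definition comp_dchart c l : cotangent p := Cotangent (comp_dchart_subproof c l).

End CotangentSpace.

Record cotangent_bundle := CotangentPoint {
  basepoint : M ; fiberpoint : cotangent basepoint }.

HB.instance Definition _ := gen_eqMixin cotangent_bundle.
HB.instance Definition _ := gen_choiceMixin cotangent_bundle.

(* The topology making the bundle charts (q, z) |-> (c q, z o dc(q)^-1)
   homeomorphisms from T^*U onto the open subsets c(U) x H^* of H x H^*. *)
Definition cotangent_open : set_system cotangent_bundle := fun O =>
  forall c, atlas S c ->
    open [set y : H * bop H R^o | chart_rng c y.1 /\
      O (CotangentPoint (comp_dchart (chart_inv c y.1) c y.2))].

Lemma cotangent_openT : cotangent_open setT.
Proof.
move=> c _; rewrite (_ : [set _ | _] = fst @^-1` chart_rng c).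
  by apply: open_comp (chart_rng_open c) => y _; exact: cvg_fst.
by apply/seteqP; split=> [y []|y].
Qed.

Lemma cotangent_openI : setI_closed cotangent_open.
Proof.
move=> O O' oO oO' c Sc; have := openI (oO c Sc) (oO' c Sc).
by congr open; apply/seteqP; split=> y /=; [move=> [[? ?] [? ?]]|move=> [? []]].
Qed.

Lemma cotangent_open_bigU (I : Type) (F : I -> set cotangent_bundle) :
  (forall i, cotangent_open (F i)) -> cotangent_open (\bigcup_i F i).
Proof.
move=> oF c Sc; have := bigcup_open (fun i (_ : setT i) => oF i c Sc).
congr open; apply/seteqP; split=> y /=.
  by move=> [i _ [? ?]]; split=> //; exists i.
by move=> [? [i _ ?]]; exists i.
Qed.

HB.instance Definition _ := isOpenTopological.Build cotangent_bundle
  cotangent_openT cotangent_openI cotangent_open_bigU.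

Definition C1_function (psi : M -> R) : Prop := forall c, atlas S c ->
  Ck 1 (chart_rng c) (psi \o chart_inv c : H -> R^o).

Definition is_differential (psi : M -> R) (p : M) (z : cotangent p) : Prop :=
  forall c, chart_at p c -> forall v : tangent p,
    z v = 'd (psi \o chart_inv c : H -> R^o) (c p) (dchart c v).

Definition subdifferential (f : M -> R) (p : M) : set (cotangent p) :=
  [set z | exists psi : M -> R, [/\ C1_function psi,
     \forall q \near p, f p - psi p <= f q - psi q &
     is_differential psi z]].

(* A Riemannian metric g is read in a chart c as a map G from c(U) to the space
   L(H, L(H, R)) of continuous bilinear forms. *)
Record riemannian_metric := RiemannianMetric {
  metric : forall p : M, {dot (tangent p) for idfun} ;
  metric_equiv : forall p c, chart_at p c ->
    exists a b : R, [/\ 0 < a, 0 < b & forall v : tangent p,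
      a * `|dchart c v| <= Num.sqrt (metric p v v) <= b * `|dchart c v| ] ;
  metric_smooth : forall c, atlas S c ->
    exists2 G : H -> bop H (bop H R^o), smooth (chart_rng c) G &
      forall x, chart_rng c x -> forall v w : H,
        G x v w = metric (chart_inv c x)
          (dchart_inv (chart_inv c x) c v) (dchart_inv (chart_inv c x) c w) }.

(* gamma' is the velocity field; at a and b the derivatives are one-sided. *)
Definition C1_path (a b : R) (gamma : R -> M)
    (gamma' : forall t, tangent (gamma t)) : Prop :=
  {within `[a, b], continuous gamma} /\
  forall c t, atlas S c -> t \in `[a, b] -> chart_dom c (gamma t) ->
    ((fun s => (s - t)^-1 *: (c (gamma s) - c (gamma t)))
       @ within `[a, b] (dnbhs t) --> dchart c (gamma' t)) /\
    ((fun s => dchart c (gamma' s))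
       @ within `[a, b] (nbhs t) --> dchart c (gamma' t)).

Variable g : riemannian_metric.

Definition path_length (a b : R) (gamma : R -> M)
    (gamma' : forall t, tangent (gamma t)) : \bar R :=
  (\int[lebesgue_measure]_(t in `[a, b])
     (Num.sqrt (metric g (gamma t) (gamma' t) (gamma' t)))%:E)%E.

(* The value is +oo for points that no C^1 path joins. *)
Definition riemannian_distance (x y : M) : \bar R :=
  ereal_inf [set L | exists (a b : R) (gamma : R -> M)
    (gamma' : forall t, tangent (gamma t)),
    [/\ a < b, C1_path a b gamma', gamma a = x, gamma b = y &
        L = path_length a b gamma']].

Definition riemannian_uniformly_continuous (f : M -> R) : Prop :=
  forall e : R, 0 < e -> exists2 d : R, 0 < d &
    forall x y, (riemannian_distance x y < d%:E)%E -> `|f x - f y| < e.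

End Manifold.

Arguments dchart_inv {R M H S} p c w.
Arguments comp_dchart {R M H S} p c l.

(* Main.v *)
Require Import Defs.
From HB Require Import structures.
From mathcomp Require Import all_boot all_order all_algebra.
From mathcomp Require Import all_classical all_reals all_analysis.
From mathcomp Require Import ring lra.

Set Implicit Arguments.
Unset Strict Implicit.
Unset Printing Implicit Defensive.

Import Order.TTheory GRing.Theory Num.Theory.
Import numFieldNormedType.Exports.

Local Open Scope classical_set_scope.
Local Open Scope ring_scope.

(** Everything is read in the chart [phi], where the statement becomes a fuzzy sum
    rule for two functions on a ball of the Hilbert space [H]: if [psi] is a test
    function for [f1 + f2] at [p], then [F1 + F2] has a local minimum at [phi p],
    where [F1 = (f1 - psi) o phi^-1] is lower semicontinuous and
    [F2 = f2 o phi^-1] is uniformly continuous near [phi p]. The latter is where the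
    Riemannian distance enters: near [phi p] the metric is bounded by a constant
    times the norm of [H], so the distance is bounded by a constant times the
    distance in the chart ([riemannian_uniformly_continuous_chart]).

    In [H] ([fuzzy_sum_rule]) the variables are decoupled. One minimizes
    [F1 x + F2 y + |x - x0|^2 + k |x - y|^2] over a small product of balls, with
    [k] large. Closed balls of an infinite-dimensional space are not compact, so a
    minimizer exists only up to a small perturbation; since squares of Hilbert norms
    are smooth, the Borwein-Preiss principle ([smooth_variational_principle])
    provides a perturbation which is a quadratic function with small coefficients.
    Freezing one coordinate of the minimizer [(x1, x2)] yields a paraboloid below
    [F1] touching it at [x1], and one below [F2] touching it at [x2]. The terms
    coming from [k |x - y|^2] cancel in the sum of the two gradients, which is
    therefore small, and [x1], [x2] are close to [phi p], with values of [F1] and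
    [F2] close to those at [phi p].

    It remains to come back to the manifold ([proximal_subdifferential]). A
    subdifferential is defined through test functions on the whole of [M], so each
    paraboloid has to be replaced by a function of small support and extended by
    zero. This is legitimate if points outside the domain of [phi] are not limits of
    points of a small ball of the chart, which holds because [M] is Hausdorff and
    [H] complete, thanks to the metric: a short path starting in the small ball has
    a short image in the chart, hence a limit there, and cannot leave the domain
    ([separated_ball_exists]). Finally, neighbourhoods in the cotangent bundle are
    read in the bundle chart of [phi] ([cotangent_nbhs_chart]), where the sum of the
    two covectors is close to the differential of [psi] at [p]. *)

(** * Sequences *)

Lemma geometric_sum (R : realType) n :
  \sum_(i < n) (2^-1 : R) ^+ i = 2 - 2 * 2^-1 ^+ n.
Proof.
elim: n => [|n IH]; first by rewrite big_ord0 expr0 mulr1 subrr.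
by rewrite big_ord_recr /= IH exprS; field.
Qed.

Lemma cvg_geometric_increments (R : realType) (H : completeNormedModType R)
    (u : nat -> H) (K : R) :
  (forall n, `|u n.+1 - u n| <= K * 2^-1 ^+ n) -> cvgn u.
Proof.
move=> uK.
have K0 : 0 <= K by have := le_trans (normr_ge0 _) (uK 0%N); rewrite expr0 mulr1.
have -> : u = cst (u 0%N) + series (fun n => u n.+1 - u n).
  apply/funext => n; rewrite /= !fctE seriesEord /=.
  have -> : \sum_(k < n) (u k.+1 - u k) = u n - u 0%N.
    by rewrite -(big_mkord xpredT (fun k => u k.+1 - u k)) telescope_sumr.
  by rewrite addrC subrK.
apply: is_cvgD; first exact: is_cvg_cst.
apply: normed_cvg.
apply: nondecreasing_is_cvgn.
  apply/nondecreasing_seqP => n; rewrite /= !seriesEnat /= !big_mkord big_ord_recr /=.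
  by rewrite lerDl.
exists (2 * K) => _ [n _ <-]; rewrite /= seriesEnat /= big_mkord.
apply: (@le_trans _ _ (\sum_(i < n) K * 2^-1 ^+ i)).
  exact: ler_sum.
rewrite -mulr_sumr geometric_sum mulrC ler_wpM2r //.
by rewrite gerBl mulr_ge0 // exprn_ge0.
Qed.

(** Minimizing sequences of this kind occur below: the n-th term almost minimizes a
    function built from all the previous terms. *)
Lemma sequence_choice (T : Type) (P : seq T -> T -> Prop) :
  (forall s, exists x, P s x) -> exists u : nat -> T, forall n, P (mkseq u n) (u n).
Proof.
move=> /choice[g gP].
pose st n := iter n (fun s => rcons s (g s)) [::].
exists (g \o st) => n.
suff -> : mkseq (g \o st) n = st n by exact: gP.
elim: n => // n IH.
by rewrite /mkseq -addn1 iotaD map_cat /= -/(mkseq _ _) IH cats1 add0n addn1.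
Qed.

(** * A smooth variational principle *)

Section VariationalPrinciple.
Context {R : realType} {W : normedModType R} (B : W -> W -> R).
Hypothesis BC : forall u v, B u v = B v u.
Hypothesis Blin : forall a u v w, B (a *: u + v) w = a * B u w + B v w.

Lemma formBl u v w : B (u - v) w = B u w - B v w.
Proof. by rewrite addrC -scaleN1r Blin mulN1r addrC. Qed.

Lemma form0l w : B 0 w = 0.
Proof. by have := formBl 0 0 w; rewrite !subrr. Qed.

Lemma formDl u v w : B (u + v) w = B u w + B v w.
Proof. by rewrite -[u]scale1r Blin scale1r mul1r. Qed.

Lemma formZl a u w : B (a *: u) w = a * B u w.
Proof. by rewrite -[a *: u]addr0 Blin form0l addr0. Qed.

Lemma formNl u w : B (- u) w = - B u w.
Proof. by rewrite -scaleN1r formZl mulN1r. Qed.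

(** Recentring a square from [y] to [v] costs an affine term only: this is why sums
    of squares centred at different points are again a single square plus an
    affine function. *)
Lemma form_shift w v y : B (w - y) (w - y) =
  B (v - y) (v - y) + B (w - v) (w - v) + 2 * B (v - y) (w - v).
Proof.
have E x z : B (x - y) z = B (x - v) z + B (v - y) z.
  by rewrite !formBl; ring.
by rewrite (E w) (BC (w - v)) (BC (v - y)) !(E w) (BC (w - v) (v - y)); ring.
Qed.

Variable K : R.
Hypothesis B_bounded : forall u v, `|B u v| <= K * `|u| * `|v|.

Lemma form_sqr_continuous y : continuous (fun w => B (w - y) (w - y) : R).
Proof.
move=> v; apply/cvgrPdist_lt => /= e e0.
have : (fun w => K * `|w - v| * `|w - v| + 2 * (K * `|v - y| * `|w - v|)) @ v
    --> K * `|v - v| * `|v - v| + 2 * (K * `|v - y| * `|v - v|).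
  have c : (fun w => `|w - v|) @ v --> `|v - v|.
    by apply: cvg_norm; apply: cvgB => //; exact: cvg_cst.
  apply: cvgD; first by apply: cvgM => //; apply: cvgM => //; exact: cvg_cst.
  by apply: cvgM; [exact: cvg_cst|apply: cvgM => //; exact: cvg_cst].
rewrite subrr normr0 !mulr0 addr0 => /cvgrPdist_lt /(_ e e0).
apply: filterS => w; rewrite sub0r normrN => ew.
rewrite distrC (form_shift w v y) addrC !addrA addNr add0r.
apply: le_lt_trans ew; apply: le_trans _ (ler_norm _).
apply: le_trans (ler_normD _ _) _; apply: lerD; first exact: B_bounded.
by rewrite normrM (ger0_norm (ler0n _ 2)) ler_wpM2l.
Qed.

(* [B] only has to be equivalent to the square of the norm: the sup norm of a
   product of Hilbert spaces is not itself Hilbertian. *)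
Hypothesis B_coercive : forall u, `|u| ^+ 2 <= B u u.
Hypothesis W_complete : forall (u : nat -> W) (c : R),
  (forall n, `|u n.+1 - u n| <= c * 2^-1 ^+ n) -> exists l : W, u @ \oo --> l.

(** The Borwein-Preiss principle. A minimizing sequence need not converge, so the
    squares [mu 2^-n B (w - w_n) (w - w_n)] are added one at a time, [w_n] being an
    almost minimizer of the function obtained so far, up to [mu 8^-n]. The n-th
    square then forces [w_n.+1] to be within [2 2^-n] of [w_n], and the limit [v]
    minimizes [h] plus all the squares. Recentred at [v], their sum is at
    most [2 mu B (w - v) (w - v)] plus a constant and a linear form, represented by
    the sum [a] of a convergent series. *)
Lemma smooth_variational_principle (C : set W) (D : R) (h : W -> R) (m mu : R) :
  closed C -> C !=set0 -> (forall u v, C u -> C v -> `|u - v| <= D) ->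
  (forall w, C w -> m <= h w) ->
  (forall v t, C v -> t < h v -> \forall w \near v, C w -> t < h w) ->
  0 < mu ->
  exists v a, [/\ C v, `|a| <= 4 * mu * D &
    forall w, C w -> h v <= h w + 2 * mu * B (w - v) (w - v) + B a (w - v)].
Proof.
move=> C_closed [x0 Cx0] C_diam hm h_lsc mu0.
pose t n : R := 2^-1 ^+ n.
have t0 n : 0 < t n by rewrite exprn_gt0 // invr_gt0.
have t1 n : t n <= 1 by rewrite exprn_ile1 // ?invr_ge0 // invf_le1 // ler1n.
have tS n : t n.+1 = t n / 2 by rewrite /t exprSr.
have D0 : 0 <= D by apply: le_trans (C_diam _ _ Cx0 Cx0).
have B0 u : 0 <= B u u by apply: le_trans (B_coercive u); rewrite exprn_ge0.
pose pert (s : seq W) w := \sum_(i < size s) mu * t i * B (w - s`_i) (w - s`_i).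
have pert0 s w : 0 <= pert s w.
  by apply: sumr_ge0 => i _; rewrite mulr_ge0 // mulr_ge0 // ltW.
(* each [w_ n] is an almost minimizer of [h] plus the squares centred at the
   previous points *)
have [s|w_ w_P] := @sequence_choice W (fun s w => C w /\ forall w', C w' ->
    h w + pert s w <= h w' + pert s w' + mu * t (size s) ^+ 3).
  pose S := [set h w + pert s w | w in C].
  have S_inf : has_inf S.
    split; first by exists (h x0 + pert s x0), x0.
    exists m => _ [w Cw <-]; rewrite -[m]addr0 lerD ?hm //.
  have d0 : 0 < mu * t (size s) ^+ 3 by rewrite mulr_gt0 // exprn_gt0.
  have [_ [w Cw <-] wS] := inf_adherent d0 S_inf.
  exists w; split=> // w' Cw'; apply: le_trans (ltW wS) _.
  by rewrite lerD2r; apply: ge_inf; [case: S_inf|exists w'].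
have Cw n : C (w_ n) by case: (w_P n).
pose q n w := \sum_(i < n) mu * t i * B (w - w_ i) (w - w_ i).
have pertE n w : pert (mkseq w_ n) w = q n w.
  rewrite /pert /q size_mkseq; apply: eq_bigr => i _.
  by rewrite nth_mkseq.
have w_min n w' : C w' -> h (w_ n) + q n (w_ n) <= h w' + q n w' + mu * t n ^+ 3.
  by move=> Cw'; case: (w_P n) => _ /(_ _ Cw'); rewrite !pertE size_mkseq.
have qS n w : q n.+1 w = q n w + mu * t n * B (w - w_ n) (w - w_ n).
  by rewrite /q big_ord_recr.
have B00 u : B (u - u) (u - u) = 0.
  by rewrite subrr form0l.
(* comparing the n-th and the next almost minimality at each other's point *)
have w_cauchy n : `|w_ n.+1 - w_ n| <= 2 * t n.
  have ha := w_min n _ (Cw n.+1).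
  have hb := w_min n.+1 _ (Cw n).
  rewrite !qS B00 tS in hb.
  have tn := t0 n.
  have tn3 : 0 <= mu * t n ^+ 3 by rewrite mulr_ge0 ?exprn_ge0 // ltW.
  have hc : mu * t n * B (w_ n.+1 - w_ n) (w_ n.+1 - w_ n) <= mu * t n * (2 * t n) ^+ 2.
    have -> : mu * t n * (2 * t n) ^+ 2 = 4 * (mu * t n ^+ 3) by ring.
    have : mu * (t n / 2) ^+ 3 = mu * t n ^+ 3 / 8 by field.
    by move=> E; rewrite E in hb; lra.
  rewrite ler_pM2l ?mulr_gt0 // in hc.
  rewrite -ler_sqr ?nnegrE ?mulr_ge0 ?(ltW (t0 _)) //.
  exact: le_trans (B_coercive _) hc.
have := W_complete w_cauchy.
move=> [v wv].
have Cv : C v by apply: (closed_cvg C C_closed _ _ wv); exact: nearW.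
(* the linear part of the first n squares recentred at [v] *)
pose a_ n := \sum_(i < n) (2 * mu * t i) *: (v - w_ i).
have a_bound n : `|a_ n| <= 4 * mu * D.
  apply: (@le_trans _ _ (\sum_(i < n) (2 * mu * D) * 2^-1 ^+ i)).
    apply: le_trans (ler_norm_sum _ _ _) _; apply: ler_sum => i _.
    rewrite normrZ ger0_norm ?mulr_ge0 // ?(ltW mu0) ?(ltW (t0 _)) //.
    rewrite mulrAC -/(t i) ler_wpM2r ?(ltW (t0 _)) // ler_wpM2l ?mulr_ge0 ?(ltW mu0) //.
    exact: C_diam.
  rewrite -mulr_sumr geometric_sum.
  rewrite (_ : 4 * mu * D = 2 * mu * D * 2); last by ring.
  by rewrite ler_wpM2l ?mulr_ge0 ?(ltW mu0) // gerBl mulr_ge0 // ltW // t0.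
have /W_complete[a av] n : `|a_ n.+1 - a_ n| <= (2 * mu * D) * t n.
  rewrite /a_ big_ord_recr /= addrAC subrr add0r.
  rewrite normrZ ger0_norm ?mulr_ge0 // ?(ltW mu0) ?(ltW (t0 _)) //.
  rewrite mulrAC ler_wpM2r ?(ltW (t0 _)) // ler_wpM2l ?mulr_ge0 ?(ltW mu0) //.
  exact: C_diam.
have q_shift n w : q n w = q n v +
    mu * (2 - 2 * t n) * B (w - v) (w - v) + B (a_ n) (w - v).
  rewrite -geometric_sum /q /a_; elim: n => [|n IH].
    by rewrite !big_ord0 mulr0 mul0r !add0r form0l.
  rewrite !big_ord_recr /= IH.
  rewrite (form_shift w v (w_ n)) -/(t n).
  rewrite (formDl (\sum_(i < n) (2 * mu * t i) *: (v - w_ i))) formZl.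
  by ring.
exists v, a; split=> //.
  have := closed_cvg [set x : R | x <= 4 * mu * D] (@closed_le _ _) _ _ (cvg_norm av).
  by apply; exact: nearW.
move=> w Cw0.
(* [eps n] bounds the tail of the squares together with the defect [mu 8^-n] *)
pose eps n := t n * (2 * mu * B (w - v) (w - v) + mu + 2 * mu * (`|K| * D * D)).
suff le_n n : h v <= h w + 2 * mu * B (w - v) (w - v) + B (a_ n) (w - v) + eps n.
  have a_cvg : (fun n => B (a_ n) (w - v)) @ \oo --> B a (w - v).
    apply/cvgrPdist_lt => /= e e0.
    have : (fun n => K * `|a - a_ n| * `|w - v|) @ \oo --> K * `|a - a| * `|w - v|.
      apply: cvgM; last exact: cvg_cst.
      apply: cvgM; first exact: cvg_cst.
      by apply: cvg_norm; apply: cvgB => //; exact: cvg_cst.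
    rewrite subrr normr0 mulr0 mul0r => /cvgrPdist_lt /(_ e e0).
    apply: filterS => n; rewrite sub0r normrN -formBl => en.
    by apply: le_lt_trans en; apply: le_trans _ (ler_norm _).
  have t_cvg : t @ \oo --> (0 : R).
    have := @cvg_geometric R 1 (2^-1).
    rewrite ger0_norm ?invr_ge0 // invf_lt1 // ltr1n => /(_ isT).
    by rewrite (_ : geometric 1 2^-1 = t) //; apply/funext => n; rewrite /geometric /= mul1r.
  have e_cvg : eps @ \oo --> 0 * (2 * mu * B (w - v) (w - v) + mu + 2 * mu * (`|K| * D * D)).
    by apply: cvgM => //; exact: cvg_cst.
  rewrite mul0r in e_cvg.
  rewrite -[leRHS]addr0.
  have E : (fun n => h w + 2 * mu * B (w - v) (w - v) + B (a_ n) (w - v) + eps n)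
      @ \oo --> h w + 2 * mu * B (w - v) (w - v) + B a (w - v) + 0.
    by apply: cvgD => //; apply: cvgD => //; exact: cvg_cst.
  rewrite -(cvg_lim _ E) //; apply: limr_ge; first by apply/cvg_ex; eexists; exact: E.
  exact: nearW.
have B_wv := B0 (w - v).
suff h_le : h v + q n v <= h w + q n w + eps n.
  rewrite (q_shift n w) in h_le.
  have : 0 <= mu * (2 * t n) * B (w - v) (w - v).
    by rewrite !mulr_ge0 // ltW.
  by rewrite /eps in h_le *; lra.
(* otherwise lower semicontinuity at [v] contradicts the almost minimality of
   [w_ k] for large k *)
rewrite leNgt; apply/negP => h_lt.
have [e e0 eE] : exists2 e, 0 < e & h v + q n v - 2 * e = h w + q n w + eps n.
  exists ((h v + q n v - (h w + q n w + eps n)) / 2); last by field.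
  by rewrite divr_gt0 // subr_gt0.
have h_near : \forall z \near v, C z -> h v - e < h z.
  by apply: h_lsc => //; rewrite ltrBlDr ltrDl.
have q_near : \forall z \near v, `|q n v - q n z| < e.
  have : q n z @[z --> v] --> q n v.
    elim: (n) => [|j IH].
      rewrite (_ : q 0%N = cst 0); first exact: cvg_cst.
      by apply/funext => z; rewrite /q big_ord0.
    rewrite (_ : q j.+1 = fun z => q j z + mu * t j * B (z - w_ j) (z - w_ j)).
      apply: cvgD => //; apply: cvgM; [exact: cvg_cst|exact: form_sqr_continuous].
    by apply/funext => z; rewrite qS.
  by move=> /cvgrPdist_lt /(_ e e0).
have [k nk [hk qk]] : exists2 k, (n <= k)%N &
    (C (w_ k) -> h v - e < h (w_ k)) /\ `|q n v - q n (w_ k)| < e.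
  have [N _ NP] := wv _ (filterI h_near q_near).
  exists (maxn n N); first exact: leq_maxl.
  by apply: NP; rewrite /= leq_maxr.
have {hk} := hk (Cw k).
have t_le : t k <= t n.
  by rewrite /t ler_wiXn2l // ?invr_ge0 // invf_le1 // ler1n.
have tk3 : t k ^+ 3 <= t k.
  by rewrite -[leRHS]expr1 ler_wiXn2l // ltW.
have D2 : 0 <= `|K| * D * D by rewrite !mulr_ge0.
have q_le x : C x ->
    q n x <= q k x <= q n x + mu * (2 * t n - 2 * t k) * (`|K| * D * D).
  move=> Cx; rewrite -(subnK nk); elim: (k - n)%N => [|j /andP[IH1 IH2]].
    by rewrite add0n subrr mulr0 mul0r addr0 lexx.
  rewrite addSn qS tS.
  have Bx : B (x - w_ (j + n)%N) (x - w_ (j + n)%N) <= `|K| * D * D.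
    apply: le_trans (ler_norm _) _; apply: le_trans (B_bounded _ _) _.
    have xD := C_diam _ _ Cx (Cw (j + n)%N).
    apply: (@le_trans _ _ (`|K| * `|x - w_ (j + n)%N| * `|x - w_ (j + n)%N|)).
      by rewrite !ler_wpM2r // ler_norm.
    by rewrite ler_pM ?mulr_ge0 // ler_wpM2l.
  have := B0 (x - w_ (j + n)%N).
  set b := B _ _ in Bx *; set d := `|K| * D * D in Bx IH2 *.
  have c0 := mulr_gt0 mu0 (t0 (j + n)%N); move=> b0.
  have b1 := ler_wpM2l (ltW c0) Bx.
  have b2 := mulr_ge0 (ltW c0) b0.
  by apply/andP; split; lra.
have := w_min k _ Cw0.
have /andP[q1 _] := q_le _ (Cw k).
have /andP[_ q2] := q_le _ Cw0.
have tn0 := t0 n; have tk0 := t0 k.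
have m1 : mu * t k ^+ 3 <= t n * mu by rewrite mulrC ler_wpM2r ?(ltW mu0) // (le_trans tk3).
have m2 : 0 <= mu * (2 * t k) * (`|K| * D * D) by rewrite !mulr_ge0 // ltW.
have m3 : 0 <= t n * (2 * mu * B (w - v) (w - v)) by rewrite !mulr_ge0 // ltW.
move/ltr_normlW : qk; rewrite /eps in eE *; lra.
Qed.
End VariationalPrinciple.

(** * The fuzzy sum rule in a Hilbert space *)

Section InnerProduct.
Context {R : realType} {H : normedModType R} (B : H -> H -> R).
Hypothesis BC : forall u v, B u v = B v u.
Hypothesis Blin : forall a u v w, B (a *: u + v) w = a * B u w + B v w.
Hypothesis B_norm : forall u, `|u| ^+ 2 = B u u.

Lemma cauchy_schwarz u v : `|B u v| <= `|u| * `|v|.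
Proof.
have [->|v0] := eqVneq v 0.
  by rewrite BC (form0l Blin) !normr0 mulr0.
have E : B ((`|v| ^+ 2) *: u - B u v *: v) ((`|v| ^+ 2) *: u - B u v *: v) =
    `|v| ^+ 2 * ((`|u| * `|v|) ^+ 2 - B u v ^+ 2).
  rewrite -scaleNr; set z := _ + _.
  have E w : B z w = `|v| ^+ 2 * B u w - B u v * B v w.
    by rewrite /z Blin (formZl Blin) mulNr.
  by rewrite E (BC u z) (BC v z) !E (BC v u) -!B_norm; ring.
have := sqr_ge0 `|(`|v| ^+ 2) *: u - B u v *: v|.
rewrite (B_norm (_ - _)) E pmulr_rge0 ?exprn_gt0 ?normr_gt0 // subr_ge0.
rewrite -[B u v ^+ 2]real_normK ?num_real //.
by rewrite ler_sqr ?nnegrE ?mulr_ge0.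
Qed.
End InnerProduct.

Section ProductForm.
Context {R : realType} {H : completeNormedModType R} (B : H -> H -> R).
Hypothesis BC : forall u v, B u v = B v u.
Hypothesis Blin : forall a u v w, B (a *: u + v) w = a * B u w + B v w.
Hypothesis B_norm : forall u, `|u| ^+ 2 = B u u.

(** The inner product of the Hilbert sum; [H * H] itself carries the sup norm. *)
Definition prod_form (u v : H * H) : R := B u.1 v.1 + B u.2 v.2.

Lemma prod_formC u v : prod_form u v = prod_form v u.
Proof. by rewrite /prod_form BC (BC u.2). Qed.

Lemma prod_form_linear a u v w :
  prod_form (a *: u + v) w = a * prod_form u w + prod_form v w.
Proof. by rewrite /prod_form /= !Blin; ring. Qed.

Lemma norm_fst_le (u : H * H) : `|u.1| <= `|u|.
Proof. by rewrite prod_normE le_max lexx. Qed.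

Lemma norm_snd_le (u : H * H) : `|u.2| <= `|u|.
Proof. by rewrite prod_normE le_max lexx orbT. Qed.

Lemma prod_form_bounded u v : `|prod_form u v| <= 2 * `|u| * `|v|.
Proof.
rewrite -mulrA mulr_natl mulr2n /prod_form; apply: le_trans (ler_normD _ _) _.
apply: lerD; apply: le_trans (cauchy_schwarz BC Blin B_norm _ _) _;
  by rewrite ler_pM // ?norm_fst_le ?norm_snd_le.
Qed.

Lemma prod_form_coercive u : `|u| ^+ 2 <= prod_form u u.
Proof.
rewrite /prod_form -!B_norm prod_normE /=.
by case: (leP `|u.1| `|u.2|) => _; rewrite ?lerDl ?lerDr exprn_ge0.
Qed.

Lemma prod_complete (u : nat -> H * H) (c : R) :
  (forall n, `|u n.+1 - u n| <= c * 2^-1 ^+ n) -> exists l : H * H, u @ \oo --> l.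
Proof.
move=> uc.
have /cvg_geometric_increments/cvg_ex[x ux] n :
    `|(fst \o u) n.+1 - (fst \o u) n| <= c * 2^-1 ^+ n.
  exact: le_trans (norm_fst_le _) (uc n).
have /cvg_geometric_increments/cvg_ex[y uy] n :
    `|(snd \o u) n.+1 - (snd \o u) n| <= c * 2^-1 ^+ n.
  exact: le_trans (norm_snd_le _) (uc n).
exists (x, y).
rewrite (_ : u = fun n => ((fst \o u) n, (snd \o u) n)); first exact: cvg_pair.
by apply/funext => n /=; case: (u n).
Qed.

(** The doubled objective: [x] and [y] range independently over the two summands
    and the penalty [k |x - y|^2] ties them together, so that a minimizer yields
    one condition on [G1] and one on [G2]; [|x - x0|^2] singles out [x0] among the
    minimizers of [G1 + G2]. *)
Definition penalized (G1 G2 : H -> R) (x0 : H) (k : R) (w : H * H) : R :=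
  G1 w.1 + G2 w.2 + (`|w.1 - x0| ^+ 2 + k * `|w.1 - w.2| ^+ 2).

Lemma penalty_continuous (x0 : H) (k : R) :
  continuous (fun w : H * H => `|w.1 - x0| ^+ 2 + k * `|w.1 - w.2| ^+ 2 : R).
Proof.
move=> v.
have c1 : w.1 @[w --> v] --> v.1 by exact: cvg_fst.
have c2 : w.2 @[w --> v] --> v.2 by exact: cvg_snd.
apply: cvgD.
  by apply: cvgM; apply: cvg_norm; apply: cvgB => //; exact: cvg_cst.
by apply: cvgM; [exact: cvg_cst|apply: cvgM; apply: cvg_norm; exact: cvgB].
Qed.

Lemma penalized_lsc (G1 G2 : H -> R) (x0 : H) (k : R) (v : H * H) (t : R) :
  (forall s, s < G1 v.1 -> \forall x \near v.1, s < G1 x) ->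
  (forall s, s < G2 v.2 -> \forall y \near v.2, s < G2 y) ->
  t < penalized G1 G2 x0 k v -> \forall w \near v, t < penalized G1 G2 x0 k w.
Proof.
move=> G1_lsc G2_lsc tv.
pose s := (penalized G1 G2 x0 k v - t) / 3.
have s0 : 0 < s by rewrite divr_gt0 // subr_gt0.
have c1 : w.1 @[w --> v] --> v.1 by exact: cvg_fst.
have c2 : w.2 @[w --> v] --> v.2 by exact: cvg_snd.
have n1 : \forall w \near v, G1 v.1 - s < G1 w.1.
  by apply: (c1 _ (G1_lsc _ _)); rewrite gtrBl.
have n2 : \forall w \near v, G2 v.2 - s < G2 w.2.
  by apply: (c2 _ (G2_lsc _ _)); rewrite gtrBl.
have /cvgrPdist_lt /(_ s s0) n3 := @penalty_continuous x0 k v.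
apply: filterS3 n1 n2 n3 => w w1 w2 /ltr_normlW w3.
have tE : t = penalized G1 G2 x0 k v - 3 * s by rewrite /s; field.
by move: tE w1 w2 w3; rewrite /penalized; clear; lra.
Qed.

(** Freezing one coordinate of the minimizer and expanding the squares around the
    other gives the two subgradients. The contributions [2 k (x1 - x2)] of the
    penalty are opposite, hence disappear from [a1 + a2] however large [k] is. *)
Lemma penalized_subgradients (G1 G2 : H -> R) (x0 x1 x2 b1 b2 : H) (r k c : R) :
  0 <= c -> `|x1 - x0| < r -> `|x2 - x0| < r ->
  (forall w : H * H, `|w.1 - x0| <= r -> `|w.2 - x0| <= r ->
     penalized G1 G2 x0 k (x1, x2) <= penalized G1 G2 x0 k w +
       c * prod_form (w - (x1, x2)) (w - (x1, x2)) + prod_form (b1, b2) (w - (x1, x2))) ->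
  exists a1 a2 : H, [/\ a1 + a2 = - (2 *: (x1 - x0) + (b1 + b2)),
    \forall x \near x1,
      G1 x1 + B a1 (x - x1) - (1 + k + c) * `|x - x1| ^+ 2 <= G1 x &
    \forall y \near x2,
      G2 x2 + B a2 (y - x2) - (1 + k + c) * `|y - x2| ^+ 2 <= G2 y].
Proof.
move=> c0 x1r x2r v_min.
have near_ball z : `|z - x0| < r -> \forall x \near z, `|x - x0| <= r.
  rewrite -subr_gt0 => p0; apply/nbhs_ballP; exists (r - `|z - x0|) => // x.
  rewrite -ball_normE /= distrC => xz; apply: le_trans (ler_distD z _ _) _.
  by move: xz; clear; lra.
exists (- (2 *: (x1 - x0) + (2 * k) *: (x1 - x2) + b1)),
  (- ((2 * k) *: (x2 - x1) + b2)); split.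
- rewrite -opprD -(opprB x1 x2) scalerN (addrAC _ _ b1) addrA addrK.
  by rewrite -addrA.
- apply: filterS (near_ball _ x1r) => x xr.
  have := v_min (x, x2) xr (ltW x2r).
  rewrite /penalized /prod_form /= subrr !(BC _ 0) !(form0l Blin) !B_norm.
  rewrite (form_shift BC Blin x x1 x0) (form_shift BC Blin x x1 x2).
  rewrite (formNl Blin) (formDl Blin _ b1) (formDl Blin (2 *: _)).
  by rewrite !(formZl Blin _ (_ - _)); clear; lra.
- apply: filterS (near_ball _ x2r) => y yr.
  have := v_min (x1, y) (ltW x1r) yr.
  rewrite /penalized /prod_form /= subrr !(BC _ 0) !(form0l Blin).
  rewrite (distrC x1 y) (distrC x1 x2) !B_norm (form_shift BC Blin y x2 x1).
  rewrite (formNl Blin) (formDl Blin _ b2) (formZl Blin _ (_ - _)).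
  have : 0 <= B (y - x2) (y - x2) by rewrite -B_norm exprn_ge0.
  by clear; lra.
Qed.

(** An almost minimizer is close to the diagonal because [k] is large; then
    minimality of [x0] for [G1 + G2] bounds [|x1 - x0|^2]. *)
Lemma penalized_almost_min_near (G1 G2 : H -> R) (x0 x1 x2 : H) (k d s : R) :
  0 <= k -> 0 < d -> 4 <= k * d ^+ 2 -> s <= 1 ->
  G1 x0 - 1 < G1 x1 -> G2 x0 - 1 < G2 x2 ->
  G1 x0 + G2 x0 <= G1 x1 + G2 x1 ->
  (`|x1 - x2| < d -> `|G2 x1 - G2 x2| <= s) ->
  penalized G1 G2 x0 k (x1, x2) <= G1 x0 + G2 x0 + s ->
  `|x1 - x2| < d /\ `|x1 - x0| ^+ 2 <= 2 * s.
Proof.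
move=> k0 d0 kd s1 G1x1 G2x2 G_min G2_close; rewrite /penalized /= => pen.
have sqr0 := exprn_ge0 2 (normr_ge0 (x1 - x0)).
have ksqr0 := mulr_ge0 k0 (exprn_ge0 2 (normr_ge0 (x1 - x2))).
have x12 : `|x1 - x2| < d.
  rewrite ltNge; apply/negP => d_le.
  have : k * d ^+ 2 <= k * `|x1 - x2| ^+ 2.
    by rewrite ler_wpM2l // ler_sqr ?nnegrE // ltW.
  by move: kd s1 G1x1 G2x2 pen sqr0; clear; lra.
split=> //; have /ler_normlP[_ G12] := G2_close x12.
by move: G_min G12 pen ksqr0; clear; lra.
Qed.

(** The variational principle on a small product of closed balls gives a minimizer
    [(x1, x2)] of the doubled objective up to a perturbation costing at most
    [20 mu]. It is close to [(x0, x0)], hence interior to the product, which makes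
    the two subgradients available; their sum is small because [x1] is close to
    [x0] and the perturbation is small. Uniform continuity of [G2] is what makes
    the gap [G2 x1 - G2 x2] small before [x1] and [x2] are known to be near [x0]. *)
Lemma fuzzy_sum_rule (x0 : H) (r0 : R) (G1 G2 : H -> R) (e : R) :
  0 < r0 ->
  (forall x t, `|x - x0| < r0 -> t < G1 x -> \forall y \near x, t < G1 y) ->
  (forall s, 0 < s -> exists2 d, 0 < d & forall x y, `|x - x0| < r0 ->
     `|y - x0| < r0 -> `|x - y| < d -> `|G2 x - G2 y| < s) ->
  (forall x, `|x - x0| < r0 -> G1 x0 + G2 x0 <= G1 x + G2 x) ->
  0 < e ->
  exists x1 x2 a1 a2 : H, exists Q : R,
    [/\ `|x1 - x0| < e /\ `|x2 - x0| < e,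
        `|G1 x1 - G1 x0| < e /\ `|G2 x2 - G2 x0| < e,
        `|a1 + a2| < e,
        \forall x \near x1, G1 x1 + B a1 (x - x1) - Q * `|x - x1| ^+ 2 <= G1 x &
        \forall x \near x2, G2 x2 + B a2 (x - x2) - Q * `|x - x2| ^+ 2 <= G2 x].
Proof.
move=> r00 G1_lsc G2_unif G_min e0.
pose e' := Num.min e 1 / 2.
have e'0 : 0 < e' by rewrite divr_gt0 // lt_min e0 ltr01.
have [e'e e'1] : e' <= e / 2 /\ e' <= 1 / 2.
  by rewrite !ler_pM2r ?invr_gt0 // !ge_min !lexx orbT.
have [d0 d00 G2d0] := G2_unif _ e'0.
have /nbhs_ballP[d1 /= d10 G1d1] : \forall y \near x0, G1 x0 - e' < G1 y.
  by apply: G1_lsc; rewrite ?subrr ?normr0 // gtrBl.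
have [r [r_gt0 r_lt rd0 rd1 [re r1]]] :
    exists r, [/\ 0 < r, r < r0, r < d0, r < d1 & r <= e / 8 /\ r <= 1].
  pose a := Num.min (Num.min r0 d0) (Num.min d1 (Num.min e 1)).
  have a0 : 0 < a by rewrite !lt_min r00 d00 d10 e0 ltr01.
  have [a1 a2] : a <= r0 /\ a <= d0 by rewrite !ge_min !lexx !orbT.
  have [a3 [a4 a5]] : a <= d1 /\ a <= e /\ a <= 1.
    by rewrite !ge_min !lexx !orbT.
  by exists (a / 8); move: a0 a1 a2 a3 a4 a5; clear; split; lra.
have in_r0 x : `|x - x0| <= r -> `|x - x0| < r0 by move=> /le_lt_trans; apply.
have G1_lb x : `|x - x0| <= r -> G1 x0 - e' < G1 x.
  by move=> xr; apply: G1d1; rewrite /= -ball_normE /= distrC (le_lt_trans xr).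
have G2_b x : `|x - x0| <= r -> `|G2 x - G2 x0| < e'.
  move=> xr; apply: G2d0; [exact: in_r0| |exact: le_lt_trans rd0].
  by rewrite subrr normr0.
have G2_lb x : `|x - x0| <= r -> G2 x0 - e' < G2 x.
  by move=> /G2_b/ltr_normlP[+ _]; clear; lra.
have G2_lsc x t : `|x - x0| < r0 -> t < G2 x -> \forall y \near x, t < G2 y.
  move=> xr0; rewrite -subr_gt0 => tx; have [d d_gt0 G2d] := G2_unif _ tx.
  apply/nbhs_ballP; exists (Num.min d (r0 - `|x - x0|)).
    by rewrite /= lt_min d_gt0 subr_gt0.
  move=> y; rewrite -ball_normE /= lt_min => /andP[xyd xyr].
  have yr0 : `|y - x0| < r0.
    apply: le_lt_trans (ler_distD x _ _) _; rewrite distrC.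
    by move: xyr; clear; lra.
  have := G2d _ _ xr0 yr0 xyd => /ltr_normlW.
  by clear; lra.
pose sg := Num.min (e' / 2) (r ^+ 2 / 32).
have sg0 : 0 < sg.
  by rewrite lt_min; apply/andP; split; apply: divr_gt0; rewrite ?exprn_gt0.
have [sge sgr] : sg <= e' / 2 /\ sg <= r ^+ 2 / 32.
  by rewrite /sg !ge_min !lexx orbT.
have [d2 d20 G2d2] := G2_unif _ sg0.
pose d := Num.min d2 (r / 4).
have d_gt0 : 0 < d by rewrite lt_min d20 divr_gt0.
have [dd2 dr] : d <= d2 /\ d <= r / 4 by rewrite /d !ge_min !lexx orbT.
(* on almost minimizers [k |x1 - x2|^2] stays below 4, whence [|x1 - x2| < d] *)
pose k := 4 / d ^+ 2.
have k0 : 0 <= k by rewrite divr_ge0 // exprn_ge0 // ltW.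
pose C : set (H * H) := [set w | `|w.1 - x0| <= r /\ `|w.2 - x0| <= r].
pose h := penalized G1 G2 x0 k.
pose mu := sg / 20.
have sgE : sg = 20 * mu by rewrite /mu; field.
have mu0 : 0 < mu by rewrite divr_gt0.
have [|||||v [a [[v1r v2r] a_le v_min]]] := smooth_variational_principle
    prod_formC prod_form_linear prod_form_bounded prod_form_coercive prod_complete
    (C := C) (D := 2 * r) (h := h) (m := G1 x0 + G2 x0 - 1) _ _ _ _ _ mu0.
- have c1 : continuous (fun w : H * H => `|w.1 - x0|).
    by move=> w; apply: cvg_norm; apply: cvgB; [exact: cvg_fst|exact: cvg_cst].
  have c2 : continuous (fun w : H * H => `|w.2 - x0|).
    by move=> w; apply: cvg_norm; apply: cvgB; [exact: cvg_snd|exact: cvg_cst].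
  have := closedI (closed_comp (fun w _ => c1 w) (@closed_le _ r))
    (closed_comp (fun w _ => c2 w) (@closed_le _ r)).
  exact.
- by exists (x0, x0); split; rewrite /= subrr normr0 ltW.
- have tri x y : `|x - x0| <= r -> `|y - x0| <= r -> `|x - y| <= 2 * r.
    move=> xr yr; apply: le_trans (ler_distD x0 _ _) _; rewrite (distrC x0).
    by move: xr yr; clear; lra.
  by move=> u w [u1 u2] [w1 w2]; rewrite prod_normE ge_max /= !tri.
- move=> w [w1 w2]; have := G1_lb _ w1; have := G2_lb _ w2.
  have := exprn_ge0 2 (normr_ge0 (w.1 - x0)).
  have := mulr_ge0 k0 (exprn_ge0 2 (normr_ge0 (w.1 - w.2))).
  by move: e'1; rewrite /h /penalized; clear; lra.
- move=> v t [v1 v2] tv.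
  have := penalized_lsc (fun s => G1_lsc v.1 s (in_r0 _ v1))
    (fun s => G2_lsc v.2 s (in_r0 _ v2)) tv.
  by apply: filterS.
case: v v1r v2r v_min => x1 x2 /= v1r v2r v_min.
case: a a_le v_min => b1 b2; rewrite prod_normE ge_max /= => /andP[b1_le b2_le] v_min.
have b_form b x : `|b| <= 4 * mu * (2 * r) -> `|x - x0| <= r ->
    `|B b (x0 - x)| <= 8 * mu.
  move=> br xr; apply: le_trans (cauchy_schwarz BC Blin B_norm _ _) _.
  apply: (@le_trans _ _ (4 * mu * (2 * r) * r)); first by rewrite ler_pM // distrC.
  have : mu * r * r <= mu * 1 * 1 by rewrite !ler_pM ?mulr_ge0 // ltW.
  by clear; lra.
have sqr_small x : `|x - x0| <= r -> B (x0 - x) (x0 - x) <= 1.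
  move=> xr; rewrite -B_norm distrC expr_le1 //; exact: le_trans xr r1.
have v0 : h (x1, x2) <= G1 x0 + G2 x0 + sg.
  have : C (x0, x0) by split; rewrite /= subrr normr0 ltW.
  move=> /v_min; rewrite {2}/h /penalized /prod_form /= subrr normr0 expr0n /=.
  rewrite mulr0 !addr0; move: (h _) => hv.
  have /ler_normlP[_ A1] := b_form _ _ b1_le v1r.
  have /ler_normlP[_ A2] := b_form _ _ b2_le v2r.
  have : 2 * mu * (B (x0 - x1) (x0 - x1) + B (x0 - x2) (x0 - x2)) <= 2 * mu * (1 + 1).
    by rewrite ler_pM2l ?mulr_gt0 // lerD ?sqr_small.
  by move: A1 A2 sgE; clear; lra.
have [||||||x12 x1_sqr] := penalized_almost_min_near k0 d_gt0 _ _ _ _ _ _ v0.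
- by rewrite /k divfK // gt_eqF // exprn_gt0.
- by move: sge e'1; clear; lra.
- by move: (G1_lb _ v1r) e'1; clear; lra.
- by move: (G2_lb _ v2r) e'1; clear; lra.
- exact/G_min/in_r0.
- move=> x12; apply/ltW/G2d2; [exact: in_r0|exact: in_r0|].
  exact: lt_le_trans dd2.
have x1_near : `|x1 - x0| <= r / 2.
  rewrite -ler_sqr ?nnegrE ?divr_ge0 ?(ltW r_gt0) // expr_div_n.
  have r2 := sqr_ge0 r; rewrite (_ : 2 ^+ 2 = 4 :> R); last by ring.
  by move: x1_sqr sgr r2; clear; lra.
have x2_near : `|x2 - x0| < r.
  apply: le_lt_trans (ler_distD x1 _ _) _; rewrite (distrC x2).
  by move: x1_near x12 dr r_gt0; clear; lra.
have x1_lt : `|x1 - x0| < r by move: x1_near r_gt0; clear; lra.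
have [||a1 [a2 [a12 prox1 prox2]]] :=
  @penalized_subgradients G1 G2 x0 x1 x2 b1 b2 r k (2 * mu) _ x1_lt x2_near.
- by rewrite mulr_ge0 // ltW.
- by move=> w w1 w2; apply: v_min.
exists x1, x2, a1, a2, (1 + k + 2 * mu).
have r_lt_e : r < e.
  by apply: le_lt_trans re _; rewrite ltr_pdivrMr // ltr_pMr // ltr1n.
split=> //.
- by rewrite !(lt_trans _ r_lt_e).
- have /ltr_normlP[G2a G2b] := G2_b _ v2r; split; last first.
    by apply: lt_le_trans (G2_b _ v2r) _; move: e'e e0; clear -BC Blin B_norm; lra.
  have G1a := G1_lb _ v1r.
  have := exprn_ge0 2 (normr_ge0 (x1 - x0)).
  have := mulr_ge0 k0 (exprn_ge0 2 (normr_ge0 (x1 - x2))).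
  move: v0 G1a G2a G2b sge e'e e'0; rewrite /h /penalized /= ltr_norml; clear -BC Blin B_norm.
  by move=> *; apply/andP; split; lra.
- rewrite a12 normrN; apply: le_lt_trans (ler_normD _ _) _.
  rewrite normrZ ger0_norm //.
  have : mu * r <= mu * 1 by rewrite ler_pM2l.
  have := ler_normD b1 b2.
  by move: b1_le b2_le x1_near re sge e'e e0 sgE mu0; clear -BC Blin B_norm; lra.
Qed.
End ProductForm.

(** * Differential calculus between normed spaces *)

Section Differentiation.
Context {R : realType}.
Implicit Types V W X : normedModType R.

Lemma is_diffP V W (f : V -> W) (L : bop V W) x :
  is_diff x f L <-> forall e : R, 0 < e ->
    \forall h \near 0, `|f (h + x) - f x - L h| <= e * `|h|.
Proof.
have E : f \o shift x = cst (f x) + L +o_ (0 : V) id <->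
    forall e : R, 0 < e -> \forall h \near 0, `|f (h + x) - f x - L h| <= e * `|h|.
  have E h : (f \o shift x - (cst (f x) + L)) h = f (h + x) - f x - L h.
    by rewrite !fctE /= opprD addrA.
  split=> [/eqaddoP + e e0|fL]; first by move=> /(_ e e0); under eq_near do rewrite E.
  by apply/eqaddoP => e e0; under eq_near do rewrite E; exact: fL.
split=> [[df dfE]|/E fL].
  by apply/E; have /diff_locallyP[_] := df; rewrite dfE.
have dE := diff_unique (@bop_continuous _ _ _ L) fL.
split=> //; apply/diff_locallyP; rewrite dE; split=> //; exact: bop_continuous.
Qed.

Lemma is_diff_near V W (f g : V -> W) (L : bop V W) x :
  (\forall y \near x, f y = g y) -> is_diff x f L -> is_diff x g L.
Proof.
move=> fg /is_diffP fL; apply/is_diffP => e e0.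
have fgx := nbhs_singleton fg.
have fg0 : \forall h \near (0 : V), f (h + x) = g (h + x).
  have : h + x @[h --> (0 : V)] --> 0 + x by apply: cvgD => //; exact: cvg_cst.
  by rewrite add0r => c; exact: (c _ fg).
by apply: filterS2 fg0 (fL e e0) => h <-; rewrite fgx.
Qed.

Lemma is_diff_quadratic V W (f : V -> W) (L : bop V W) x (K : R) :
  (forall h, `|h| <= 1 -> `|f (h + x) - f x - L h| <= K * `|h| ^+ 2) ->
  is_diff x f L.
Proof.
move=> fL; apply/is_diffP => e e0.
have K0 : 0 < `|K| + 1 by rewrite ltr_wpDl.
have d0 : 0 < Num.min 1 (e / (`|K| + 1)) by rewrite lt_min ltr01 divr_gt0.
apply/nbhs_ballP; exists (Num.min 1 (e / (`|K| + 1))) => //= h.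
rewrite -ball_normE /= sub0r normrN lt_min => /andP[h1].
rewrite ltr_pdivlMr // => he.
apply: le_trans (fL h (ltW h1)) _; rewrite expr2 mulrA ler_wpM2r //.
apply: le_trans (ltW he); rewrite mulrC ler_wpM2l //.
by apply: le_trans (ler_norm _) _; rewrite lerDl.
Qed.

Lemma bop_is_diff_unique V W (f : V -> W) (L L' : bop V W) x :
  is_diff x f L -> is_diff x f L' -> L = L'.
Proof.
move=> [_ fL] [_ fL']; apply/val_inj; exact: etrans (esym fL) fL'.
Qed.

Fact bop_comp_subproof V W X (g : bop W X) (f : bop V W) :
  (g \o f : V -> X) \in continuous_linear.
Proof.
apply/asboolP; split=> [a u v|x]; first by rewrite /= !linearP.
by apply: continuous_comp; exact: bop_continuous.
Qed.
Definition bop_comp V W X (g : bop W X) (f : bop V W) : bop V X :=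
  Bop (bop_comp_subproof g f).

Lemma bop_subE V W (f g : bop V W) x : (f - g) x = f x - g x.
Proof. by []. Qed.

Lemma bop_normE V W (f : bop V W) : `|f| = opnorm f. Proof. by []. Qed.

Lemma bop_comp_norm V W X (g : bop W X) (f : bop V W) :
  `|bop_comp g f| <= `|g| * `|f|.
Proof.
apply: opnorm_le => x x1 /=; apply: le_trans (opnorm_bound _ _) _.
rewrite -bop_normE ler_wpM2l //; apply: le_trans (opnorm_bound _ _) _.
by rewrite ler_piMr ?opnorm_ge0.
Qed.

Lemma bop_compB V W X (g g' : bop W X) (f f' : bop V W) :
  bop_comp g f - bop_comp g' f' = bop_comp (g - g') f + bop_comp g' (f - f').
Proof.
apply/val_inj/funext => x.
have -> : val (bop_comp g f - bop_comp g' f') x = g (f x) - g' (f' x) by [].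
have -> : val (bop_comp (g - g') f + bop_comp g' (f - f')) x =
  (g (f x) - g' (f x)) + g' (f x - f' x) by [].
by rewrite linearB addrA subrK.
Qed.

Lemma cvg_bop_comp V W X (T : Type) (F : set_system T) (FF : Filter F)
    (g : T -> bop W X) (f : T -> bop V W) g0 f0 :
  g @ F --> g0 -> f @ F --> f0 -> (fun t => bop_comp (g t) (f t)) @ F --> bop_comp g0 f0.
Proof.
move=> gg ff; apply/cvgrPdist_lt => e e0.
have : (fun t => `|g0 - g t| * `|f0| + `|g t| * `|f0 - f t|) @ F -->
    `|g0 - g0| * `|f0| + `|g0| * `|f0 - f0|.
  apply: cvgD; apply: cvgM.
  - by apply: cvg_norm; apply: cvgB => //; exact: cvg_cst.
  - exact: cvg_cst.
  - exact: cvg_norm.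
  - by apply: cvg_norm; apply: cvgB => //; exact: cvg_cst.
rewrite !subrr !normr0 mul0r mulr0 addr0 => /cvgrPdist_lt /(_ e e0).
apply: filterS => t; rewrite sub0r normrN bop_compB => te.
apply: le_lt_trans te; apply: le_trans _ (ler_norm _).
by apply: le_trans (ler_normD _ _) _; apply: lerD; exact: bop_comp_norm.
Qed.

Lemma cvg_bop_eval V W (T : Type) (F : set_system T) (FF : Filter F)
    (f : T -> bop V W) (f0 : bop V W) w :
  f @ F --> f0 -> (fun t => f t w) @ F --> f0 w.
Proof.
move=> ff; apply/cvgrPdist_lt => e e0.
have : (fun t => `|f0 - f t| * `|w|) @ F --> `|f0 - f0| * `|w|.
  apply: cvgM; last exact: cvg_cst.
  by apply: cvg_norm; apply: cvgB => //; exact: cvg_cst.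
rewrite subrr normr0 mul0r => /cvgrPdist_lt /(_ e e0).
apply: filterS => t; rewrite sub0r normrN -bop_subE => te.
apply: le_lt_trans te; apply: le_trans _ (ler_norm _).
exact: (opnorm_bound (f0 - f t) w).
Qed.

Lemma Ck1_comp V W X (A : set V) (A' : set W) (f : V -> W) (g : W -> X) :
  Ck 1 A f -> Ck 1 A' g -> (forall x, A x -> A' (f x)) -> Ck 1 A (g \o f).
Proof.
move=> [Df fDf cDf] [Dg gDg cDg] AA'.
exists (fun x => bop_comp (Dg (f x)) (Df x)) => x Ax.
  by have ? := fDf x Ax; have ? := gDg _ (AA' _ Ax); exact: is_diff_comp.
apply: cvg_bop_comp; last exact: cDf.
have fx : {for x, continuous f}.
  by have [df _] := fDf x Ax; exact: differentiable_continuous.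
by apply: (cvg_comp f Dg fx); exact/cDg/AA'.
Qed.

Lemma Ck1D V W (A : set V) (f g : V -> W) :
  Ck 1 A f -> Ck 1 A g -> Ck 1 A (f + g).
Proof.
move=> [Df fDf cDf] [Dg gDg cDg]; exists (fun x => Df x + Dg x) => x Ax.
  by have ? := fDf x Ax; have ? := gDg x Ax; exact: is_diffD.
by apply: cvgD; [exact: cDf|exact: cDg].
Qed.

Lemma Ck1_cst V W (A : set V) (a : W) : Ck 1 A (cst a).
Proof.
exists (fun=> 0) => x _; last exact: cvg_cst.
by have := is_diff_cst a x.
Qed.

(** The derivatives provided locally agree by uniqueness of the differential, so
    they glue; in particular the resulting derivative is continuous. *)
Lemma Ck1_local V W (A : set V) (f : V -> W) : open A ->
  (forall x, A x -> exists A' g, [/\ open A', A' x, forall y, A' y -> g y = f y &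
    Ck 1 A' g]) ->
  Ck 1 A f.
Proof.
move=> oA loc.
have loc_diff x A' g (D : bop V W) : open A' -> A' x -> (forall y, A' y -> g y = f y) ->
    is_diff x g D -> is_diff x f D.
  move=> oA' A'x gf; apply: is_diff_near.
  by apply: filterS (open_nbhs_nbhs (conj oA' A'x)) => y; exact: gf.
have /choice[Df DfP] x : exists L : bop V W, A x -> is_diff x f L.
  have [Ax|nAx] := pselect (A x); last by exists 0.
  have [A' [g [oA' A'x gf [D DP _]]]] := loc x Ax; exists (D x) => _.
  exact: loc_diff oA' A'x gf (DP x A'x).
exists Df => [x|x Ax]; first exact: DfP.
have [A' [g [oA' A'x gf [D DP cD]]]] := loc x Ax.
have DfE y : A' y -> A y -> D y = Df y.
  move=> A'y Ay.
  exact: bop_is_diff_unique (loc_diff _ _ _ _ oA' A'y gf (DP y A'y)) (DfP y Ay).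
have cx : D @ x --> Df x by rewrite -DfE //; exact: cD.
apply: cvg_trans cx; apply: near_eq_cvg.
apply: filterS2 (open_nbhs_nbhs (conj oA Ax)) (open_nbhs_nbhs (conj oA' A'x)).
by move=> y Ay A'y; exact: DfE.
Qed.

End Differentiation.

(** * Riesz forms and parabolic bumps *)

Section ConcaveBump.
Context {R : realType} {H : normedModType R} (B : H -> H -> R).
Hypothesis BC : forall u v, B u v = B v u.
Hypothesis Blin : forall a u v w, B (a *: u + v) w = a * B u w + B v w.
Hypothesis B_norm : forall u, `|u| ^+ 2 = B u u.

Fact riesz_subproof a : (B a : H -> R^o) \in continuous_linear.
Proof.
have Br c u v : B a (c *: u + v) = c * B a u + B a v by rewrite BC Blin !(BC _ a).
apply/asboolP; split=> [c u v|x]; first exact: Br.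
apply/cvgrPdist_lt => e e0.
have : (fun y => `|a| * `|x - y|) @ x --> `|a| * `|x - x|.
  apply: cvgM; first exact: cvg_cst.
  by apply: cvg_norm; apply: cvgB => //; exact: cvg_cst.
rewrite subrr normr0 mulr0 => /cvgrPdist_lt /(_ e e0).
apply: filterS => y; rewrite sub0r normrN => ye.
rewrite (BC a x) (BC a y) -(formBl Blin) BC.
apply: le_lt_trans ye; apply: le_trans _ (ler_norm _).
exact: cauchy_schwarz BC Blin B_norm _ _.
Qed.
Definition riesz a : bop H R^o := Bop (riesz_subproof a).

Lemma rieszE a x : riesz a x = B a x. Proof. by []. Qed.

Lemma rieszD a b : riesz (a + b) = riesz a + riesz b.
Proof. by apply/val_inj/funext => x; rewrite /= (formDl Blin). Qed.

Lemma rieszB a b : riesz (a - b) = riesz a - riesz b.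
Proof. by apply/val_inj/funext => x; rewrite /= (formBl Blin). Qed.

Lemma riesz_norm a : `|riesz a| <= `|a|.
Proof.
apply: opnorm_le => x x1; apply: le_trans (cauchy_schwarz BC Blin B_norm _ _) _.
by rewrite ler_piMr.
Qed.

Lemma riesz_continuous : continuous riesz.
Proof.
move=> a; apply/cvgrPdist_lt => e e0.
apply/nbhs_ballP; exists e => //= b; rewrite -ball_normE /= => ab.
by rewrite -rieszB; apply: le_lt_trans ab; exact: riesz_norm.
Qed.

(** The function [t |-> max 0 t ^+ 2 / 2] is continuously differentiable, with
    derivative [max 0 t], because of this quadratic remainder. *)
Lemma half_sqr_pos_part (u k : R) :
  `|Num.max 0 (u + k) ^+ 2 / 2 - Num.max 0 u ^+ 2 / 2 - Num.max 0 u * k| <= k ^+ 2 / 2.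
Proof.
have := sqr_ge0 (u + k); have := sqr_ge0 u.
by case: (lerP 0 u) => u0; case: (lerP 0 (u + k)) => uk0 *;
  rewrite ler_norml; apply/andP; split; nra.
Qed.

Variables (a x1 : H) (Q : R).

Definition bump_arg x : R := 1 + B a (x - x1) - Q * `|x - x1| ^+ 2.
(** Half the square of the positive part of a concave parabola: one formula gives a
    continuously differentiable function with the gradient [a] at [x1], a support
    that shrinks to [x1] as [Q] grows, and an arbitrarily concave behaviour near
    [x1]. *)
Definition parabolic_bump x : R^o := Num.max 0 (bump_arg x) ^+ 2 / 2.
Definition bump_grad x := Num.max 0 (bump_arg x) *: riesz (a - (2 * Q) *: (x - x1)).

Lemma bump_argD x h : bump_arg (h + x) =
  bump_arg x + (B (a - (2 * Q) *: (x - x1)) h - Q * `|h| ^+ 2).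
Proof.
rewrite /bump_arg -(addrA h x); set y := x - x1.
have -> : `|h + y| ^+ 2 = `|h| ^+ 2 + 2 * B y h + `|y| ^+ 2.
  rewrite !B_norm (formDl Blin h) (BC h (h + y)) (BC y (h + y)) !(formDl Blin h).
  by rewrite (BC h y); ring.
rewrite (BC a (h + y)) (formDl Blin h) (BC h a) (BC y a).
by rewrite (formBl Blin a) (formZl Blin); ring.
Qed.

Lemma bump_is_diff x : is_diff x parabolic_bump (bump_grad x).
Proof.
set b := a - (2 * Q) *: (x - x1).
pose m := Num.max 0 (bump_arg x).
have m0 : 0 <= m by rewrite le_max lexx.
apply: (@is_diff_quadratic _ _ _ _ _ _ ((`|b| + `|Q|) ^+ 2 / 2 + m * `|Q|)) => h h1.
have -> : parabolic_bump (h + x) - parabolic_bump x - bump_grad x h =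
    (parabolic_bump (h + x) - parabolic_bump x - m * (B b h - Q * `|h| ^+ 2)) -
    m * (Q * `|h| ^+ 2).
  by rewrite (_ : bump_grad x h = m * B b h) //; ring.
rewrite mulrDl; apply: le_trans (ler_normB _ _) _; apply: lerD; last first.
  by rewrite normrM (normrM Q) (ger0_norm m0) (ger0_norm (sqr_ge0 _)) mulrA.
rewrite /parabolic_bump bump_argD; apply: le_trans (half_sqr_pos_part _ _) _.
rewrite -/b [leRHS]mulrAC ler_pM2r ?invr_gt0 // -exprMn -real_normK ?num_real //.
rewrite ler_sqr ?nnegrE ?mulr_ge0 ?addr_ge0 //.
apply: le_trans (ler_normB _ _) _; rewrite mulrDl; apply: lerD.
  exact: cauchy_schwarz BC Blin B_norm _ _.
rewrite normrM ler_wpM2l // ger0_norm ?sqr_ge0 // expr2 ler_piMr //.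
Qed.

Lemma bump_grad_continuous : continuous bump_grad.
Proof.
have xc x : y - x1 @[y --> x] --> x - x1 by apply: cvgB => //; exact: cvg_cst.
have arg_cont : continuous (bump_arg : H -> R^o).
  move=> x; apply: cvgB; [apply: cvgD; first exact: cvg_cst|].
    apply: (cvg_comp (fun y => y - x1) (riesz a) (xc x)).
    exact: (@bop_continuous _ _ _ (riesz a)).
  apply: cvgM; first exact: cvg_cst.
  by apply: cvgM; apply: cvg_norm; exact: xc.
move=> x; apply: cvgZ.
  have maxE (u : R) : Num.max 0 u = (u + `|u|) / 2 by case: (ger0P u) => u0; lra.
  rewrite (_ : (fun y => _) = (fun y => (bump_arg y + `|bump_arg y|) / 2)).
    rewrite maxE; apply: cvgM; last exact: cvg_cst.
    by apply: cvgD; [exact: arg_cont|apply: cvg_norm; exact: arg_cont].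
  by apply/funext => y; rewrite maxE.
apply: (cvg_comp (fun y => a - (2 * Q) *: (y - x1)) riesz); last exact: riesz_continuous.
by apply: cvgB; [exact: cvg_cst|apply: cvgZr; exact: xc].
Qed.

Lemma bump_C1 : Ck 1 setT parabolic_bump.
Proof.
by exists bump_grad => x _; [exact: bump_is_diff|exact: bump_grad_continuous].
Qed.

Lemma bump_grad_center : bump_grad x1 = riesz a.
Proof.
rewrite /bump_grad /bump_arg subrr normr0 BC (form0l Blin) scaler0 subr0.
by rewrite expr0n mulr0 subr0 addr0 max_r // scale1r.
Qed.

Lemma bump_support (r : R) x : 0 < r -> r ^- 2 + `|a| / r <= Q ->
  r <= `|x - x1| -> parabolic_bump x = 0.
Proof.
move=> r0 rQ xr; rewrite /parabolic_bump max_l ?expr0n ?mul0r //.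
rewrite /bump_arg.
have := cauchy_schwarz BC Blin B_norm a (x - x1) => /ler_normlP[_].
move: (`|x - x1|) xr => t rt Bt.
have t0 : 0 < t by exact: lt_le_trans rt.
have : (r ^- 2 + `|a| / r) * t ^+ 2 <= Q * t ^+ 2 by rewrite ler_wpM2r ?exprn_ge0 // ltW.
have tr : 1 <= t / r by rewrite ler_pdivlMr // mul1r.
have -> : (r ^- 2 + `|a| / r) * t ^+ 2 = (t / r) ^+ 2 + `|a| * t * (t / r).
  by field; rewrite gt_eqF.
have : 1 <= (t / r) ^+ 2 by rewrite expr_ge1 // ltW // divr_gt0.
have : `|a| * t * 1 <= `|a| * t * (t / r) by rewrite ler_wpM2l // mulr_ge0 // ltW.
lra.
Qed.

(** Near [x1] the parabola is [1 + q] with [q] small, and [(1 + q)^2 / 2] exceeds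
    [1 / 2 + q] by [q^2 / 2] only, which a quadratic term absorbs. *)
Lemma bump_concave : \forall x \near x1, parabolic_bump x <=
  parabolic_bump x1 + B a (x - x1) - (Q - (`|a| + 1) ^+ 2 / 2) * `|x - x1| ^+ 2.
Proof.
have d0 : 0 < (`|Q| + 1)^-1 by rewrite invr_gt0 ltr_wpDl.
apply/nbhs_ballP; exists ((`|Q| + 1)^-1) => //= x; rewrite -ball_normE /= distrC.
rewrite -[_^-1]mul1r ltr_pdivlMr ?ltr_wpDl // => xQ.
have -> : parabolic_bump x1 = 1 / 2.
  rewrite /parabolic_bump /bump_arg subrr normr0 BC (form0l Blin) expr0n mulr0 subr0 addr0.
  by rewrite max_r // expr1n.
pose q := B a (x - x1) - Q * `|x - x1| ^+ 2.
have : parabolic_bump x <= (1 + q) ^+ 2 / 2.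
  rewrite /parabolic_bump ler_pM2r ?invr_gt0 // /bump_arg -addrA -/q.
  by case: (lerP 0 (1 + q)) => // _; rewrite expr0n sqr_ge0.
have : `|q| <= (`|a| + 1) * `|x - x1|.
  apply: le_trans (ler_normB _ _) _; rewrite mulrDl mul1r; apply: lerD.
    exact: cauchy_schwarz BC Blin B_norm _ _.
  rewrite normrM (ger0_norm (sqr_ge0 _)) expr2 mulrA ler_piMl //.
  have := normr_ge0 (x - x1); lra.
have : 0 <= (`|a| + 1) * `|x - x1| by rewrite mulr_ge0 // addr_ge0.
move=> ? q_le.
have : q ^+ 2 <= ((`|a| + 1) * `|x - x1|) ^+ 2.
  by rewrite -real_normK ?num_real // ler_sqr ?nnegrE.
have : B a (x - x1) = q + Q * `|x - x1| ^+ 2 by rewrite /q subrK.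
rewrite exprMn => ->.
lra.
Qed.

End ConcaveBump.

(** * Functions on a manifold read in charts *)

Section Charts.
Context {R : realType} {M : topologicalType} {H : normedModType R}.
Implicit Types c phi : @chart R M H.

Lemma chart_rng_nbhs c q : chart_dom c q -> nbhs (c q) (chart_rng c).
Proof.
by move=> cq; apply: open_nbhs_nbhs; split; [exact: chart_rng_open|exists q].
Qed.

Lemma chart_dom_nbhs c q : chart_dom c q -> nbhs q (chart_dom c).
Proof. by move=> cq; apply: open_nbhs_nbhs; split=> //; exact: chart_dom_open. Qed.

Lemma near_chart_inv c q (P : set M) : chart_dom c q ->
  nbhs q P -> \forall x \near c q, P (chart_inv c x).
Proof.
move=> cq qP; apply: (@chart_inv_continuous _ _ _ c (c q)); first by exists q.
by rewrite chart_funK.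
Qed.

Lemma near_chart c q (P : set H) : chart_dom c q ->
  nbhs (c q) P -> \forall q' \near q, P (c q').
Proof. by move=> cq; exact: chart_fun_continuous. Qed.

Lemma open_overlap c c' : open (c @` (chart_dom c `&` chart_dom c')).
Proof.
rewrite openE => _ [q [cq c'q] <-].
apply: filterS2 (chart_rng_nbhs cq) (near_chart_inv cq (chart_dom_nbhs c'q)).
by move=> _ [q' cq' <-]; rewrite chart_funK // => c'q'; exists q'.
Qed.

Definition zero_extension phi (theta : H -> R) (q : M) : R :=
  if `[< chart_dom phi q >] then theta (phi q) else 0.

Variable S : @smooth_structure R M H.

Lemma C1_function_cst (a : R) : C1_function S (fun=> a).
Proof. by move=> c Sc; exact: (@Ck1_cst R H R^o _ a). Qed.

Lemma C1_functionD (u v : M -> R) :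
  C1_function S u -> C1_function S v -> C1_function S (u \+ v).
Proof.
move=> uC vC c Sc.
exact: (@Ck1D _ H R^o _ (u \o chart_inv c) (v \o chart_inv c) (uC c Sc) (vC c Sc)).
Qed.

(** The inverse image of the ball by the chart is closed off from the points outside
    the domain. Without local compactness this is not automatic, and it is what
    makes extension by zero of a function supported in the ball legitimate. *)
Definition separated_ball phi (x0 : H) (r : R) := forall q, ~ chart_dom phi q ->
  \forall q' \near q, chart_dom phi q' -> r <= `|phi q' - x0|.

Lemma zero_extension_C1 phi (theta : H -> R^o) x0 r :
  atlas S phi -> separated_ball phi x0 r -> Ck 1 setT theta ->
  (forall x, r <= `|x - x0| -> theta x = 0) ->
  C1_function S (zero_extension phi theta).
Proof.
move=> Sphi sep theta1 theta0 c Sc.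
apply: Ck1_local => [|_ [q cq <-]]; first exact: chart_rng_open.
have [phiq|nphiq] := pselect (chart_dom phi q).
  exists (c @` (chart_dom c `&` chart_dom phi)), (theta \o (phi \o chart_inv c)).
  split; [exact: open_overlap|by exists q| |].
    move=> _ [q' [cq' phiq'] <-].
    by rewrite /= chart_funK // /zero_extension asboolT.
  by apply: Ck1_comp theta1 _ => //; exact: (atlas_transition Sc Sphi 1%N).
have ext0 : \forall q' \near q, zero_extension phi theta q' = 0.
  apply: filterS (sep q nphiq) => q' phir.
  rewrite /zero_extension; case: asboolP => // phiq'.
  by apply: theta0; exact: phir.
have : nbhs (c q) [set x | zero_extension phi theta (chart_inv c x) = 0] :=
  near_chart_inv cq ext0.
rewrite nbhsE => -[A' [oA' A'x] A'0].
exists A', (cst 0); split=> //; last exact: Ck1_cst.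
by move=> y A'y; rewrite [RHS]A'0.
Qed.

(** By the chain rule one chart is enough to recognize the differential. *)
Lemma is_differential_chart (u : M -> R) p phi (L : bop H R^o) :
  C1_function S u -> chart_at S p phi ->
  is_diff (phi p) (u \o chart_inv phi : H -> R^o) L ->
  is_differential u (comp_dchart (S := S) p phi L).
Proof.
move=> u1 pphi uL c pc v.
have [Sphi phip] := pphi; have [Sc cp] := pc.
rewrite /= -(dchartK pc v) (dchart_invE _ pc pphi) (dchart_invK pc).
have E : (phi \o chart_inv c) (c p) = phi p by rewrite /= chart_funK.
have dphi : differentiable (phi \o chart_inv c) (c p).
  exact: is_diff_transition pc pphi.
have du : is_diff ((phi \o chart_inv c) (c p)) (u \o chart_inv phi : H -> R^o) L.
  by rewrite E.
have dT : is_diff (c p) (phi \o chart_inv c) ('d (phi \o chart_inv c) (c p)) by split.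
have dcomp := is_diff_comp dT du.
have [D DP _] := u1 c Sc.
have [dc _] := DP (c p) (ex_intro2 _ _ p cp erefl).
have -> : 'd (u \o chart_inv c : H -> R^o) (c p) (dchart c v) =
  'd ((u \o chart_inv phi) \o (phi \o chart_inv c) : H -> R^o) (c p) (dchart c v).
  apply: near_eq_diff; [|exact: dc|exact: (@ex_diff _ _ _ _ _ _ _ dcomp)].
  have phi_near : \forall x \near c p, chart_dom phi (chart_inv c x).
    exact: near_chart_inv cp (chart_dom_nbhs phip).
  by apply: filterS phi_near => x phix; rewrite /= chart_funK.
by rewrite (@diff_val _ _ _ _ _ _ _ dcomp).
Qed.

End Charts.

(** * From proximal subgradients to subdifferentials *)

Section ProximalSubgradient.
Context {R : realType} {M : topologicalType} {H : normedModType R}.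
Context (S : @smooth_structure R M H) (B : H -> H -> R).
Hypothesis BC : forall u v, B u v = B v u.
Hypothesis Blin : forall a u v w, B (a *: u + v) w = a * B u w + B v w.
Hypothesis B_norm : forall u, `|u| ^+ 2 = B u u.

(** A proximal subgradient only provides a paraboloid below [f - psi] near [p], whereas
    a test function has to be defined and continuously differentiable on the whole
    manifold: the paraboloid is replaced by a parabolic bump which, up to a constant, lies
    below it near [phi p], and which is supported in the separated ball. *)
Lemma proximal_subdifferential phi (x0 : H) (r : R) (f psi : M -> R) p
    (L : bop H R^o) (a : H) (Q : R) :
  chart_at S p phi -> separated_ball phi x0 r -> `|phi p - x0| < r ->
  C1_function S psi -> is_diff (phi p) (psi \o chart_inv phi : H -> R^o) L ->
  (\forall x \near phi p, f p - psi p + B a (x - phi p) - Q * `|x - phi p| ^+ 2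
     <= f (chart_inv phi x) - psi (chart_inv phi x)) ->
  subdifferential f (comp_dchart (S := S) p phi (riesz BC Blin B_norm a + L)).
Proof.
move=> pphi sep pr psi1 psiL prox; have [Sphi phip] := pphi.
pose d := r - `|phi p - x0|.
have d0 : 0 < d by rewrite subr_gt0.
pose Q1 := d ^- 2 + `|a| / d + `|Q| + (`|a| + 1) ^+ 2 / 2.
pose theta := parabolic_bump B a (phi p) Q1.
have theta0 x : r <= `|x - x0| -> theta x = 0.
  move=> xr; apply: (@bump_support _ _ B BC Blin B_norm _ _ _ d) => //.
    by rewrite /Q1 -addrA lerDl addr_ge0 // divr_ge0 // sqr_ge0.
  rewrite lerBlDr; apply: le_trans xr _; exact: ler_distD.
have ext1 : C1_function S (zero_extension phi theta).
  apply: zero_extension_C1 Sphi sep _ theta0; exact: bump_C1.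
exists (psi \+ zero_extension phi theta); split.
- exact: C1_functionD.
- have conc := bump_concave BC Blin B_norm a (phi p) Q1.
  apply: filterS3 (chart_dom_nbhs phip) (near_chart phip prox) (near_chart phip conc).
  move=> q phiq; rewrite /= chart_funK // /zero_extension !asboolT // -/theta.
  have : 0 <= (Q1 - (`|a| + 1) ^+ 2 / 2 - Q) * `|phi q - phi p| ^+ 2.
    rewrite mulr_ge0 ?sqr_ge0 // /Q1 addrK.
    have := ler_norm Q.
    have : 0 <= d ^- 2 + `|a| / d.
      by rewrite addr_ge0 // ?divr_ge0 // ?invr_ge0 ?sqr_ge0 // ltW.
    by lra.
  by clear; lra.
- apply: is_differential_chart => //; first exact: C1_functionD.
  rewrite addrC.
  have thetaL : is_diff (phi p) (zero_extension phi theta \o chart_inv phi : H -> R^o)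
      (riesz BC Blin B_norm a).
    apply: (@is_diff_near _ _ _ theta); last first.
      rewrite -(bump_grad_center BC Blin B_norm a (phi p) Q1); exact: bump_is_diff.
    apply: filterS (chart_rng_nbhs phip) => _ [q phiq <-].
    by rewrite /= chart_funK // /zero_extension asboolT.
  have dD := is_diffD psiL thetaL.
  exact: dD.
Qed.
End ProximalSubgradient.

(** * Real induction and the mean value inequality *)

(** The infimum of the points of [[0, 1]] where [P] fails would have to satisfy [P],
    and then so would a neighbourhood of it. *)
Lemma real_induction (R : realType) (P : R -> Prop) : P 0 ->
  (forall t, 0 <= t <= 1 -> P t -> \forall s \near t, P s) ->
  (forall t, 0 < t <= 1 -> (forall s, 0 <= s < t -> P s) -> P t) ->
  forall t, 0 <= t <= 1 -> P t.
Proof.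
move=> P0 P_open P_closed t1 t1P; apply: contrapT => nPt1.
pose A : set R := [set t | 0 <= t <= 1 /\ ~ P t].
have A_inf : has_inf A.
  by split; [exists t1|exists 0 => t [/andP[]]].
pose s := inf A.
have s0 : 0 <= s by apply: lb_le_inf => [|t [/andP[]]] //; case: A_inf.
have s_lb t : A t -> s <= t by apply: ge_inf; case: A_inf.
have s1 : s <= 1.
  by apply: le_trans (s_lb t1 _) _ => //; case/andP: t1P.
have P_before t : 0 <= t < s -> P t.
  move=> /andP[t0 ts]; apply: contrapT => nPt.
  suff : s <= t by rewrite leNgt ts.
  by apply: s_lb; split=> //; rewrite t0 (le_trans (ltW ts)).
have Ps : P s.
  have [/eqP|sn0] := eqVneq s 0; first by move/eqP->.
  by apply: P_closed => //; rewrite lt_def sn0 s0.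
have /P_open/(_ Ps)/nbhs_ballP[e /= e0 Pe] : 0 <= s <= 1 by rewrite s0.
have [t [t01 nPt] ts] := inf_adherent e0 A_inf.
have st := s_lb t (conj t01 nPt).
apply: nPt; apply: Pe; rewrite -ball_normE /= distrC ger0_norm.
  by rewrite ltrBlDl.
by rewrite subr_ge0.
Qed.

Section MeanValue.
Context {R : realType} {H : normedModType R} (B : H -> H -> R).
Hypothesis BC : forall u v, B u v = B v u.
Hypothesis Blin : forall a u v w, B (a *: u + v) w = a * B u w + B v w.
Hypothesis B_norm : forall u, `|u| ^+ 2 = B u u.

(** The scalar mean value theorem applied to the component of [u] along the increment
    [u b - u a]. *)
Lemma mean_value_inequality (u : R -> H) (K a b : R) :
  a <= b -> (forall t, a <= t <= b -> derivable u t 1) ->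
  (forall t, a <= t <= b -> `|'D_1 u t| <= K) -> `|u b - u a| <= K * (b - a).
Proof.
move=> ab uD duK.
set e := u b - u a.
have [e0|e0] := eqVneq e 0.
  rewrite e0 normr0 mulr_ge0 ?subr_ge0 //; apply: le_trans (duK a _) => //.
  by rewrite lexx ab.
pose L := riesz BC Blin B_norm e.
have Lc : continuous L by exact: bop_continuous.
pose f : R -> R^o := L \o u.
have fD t : a <= t <= b -> is_derive t 1 f (B e ('D_1 u t)).
  move=> /uD/derivable1_diffP ut.
  have Lt : differentiable L (u t) by exact: linear_differentiable.
  have ft : differentiable f t by exact: differentiable_comp.
  split; first exact/derivable1_diffP.
  rewrite deriveE // diff_comp // deriveE //.
  by rewrite -[LHS]/('d L (u t) ('d u t 1)) diff_lin.
have [||t t_ab] := @MVT_segment R f (fun t => B e ('D_1 u t)) a b ab.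
- by move=> t; rewrite in_itv /= => /andP[at_ tb]; apply: fD; rewrite !ltW.
- apply: derivable_within_continuous => t; rewrite in_itv /=.
  by move=> /fD[].
rewrite in_itv /= in t_ab.
have -> : f b - f a = L e by rewrite /f /comp /e linearB.
rewrite rieszE -B_norm => E; have : `|e| * `|e| <= `|e| * (K * (b - a)).
  rewrite -expr2 E mulrA ler_wpM2r ?subr_ge0 //.
  apply: le_trans (ler_norm _) _; apply: le_trans (cauchy_schwarz BC Blin B_norm _ _) _.
  by rewrite ler_wpM2l // duK.
by rewrite ler_pM2l // normr_gt0.
Qed.
End MeanValue.

(** * Local bounds on a Riemannian metric *)

Section MetricBounds.
Context {R : realType} {M : topologicalType} {H : normedModType R}.
Context (S : @smooth_structure R M H) (g : riemannian_metric S).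

Definition metric_norm (q : M) (v : tangent S q) : R := Num.sqrt (metric g q v v).

Lemma metric_ge0 (q : M) (v : tangent S q) : 0 <= metric g q v v.
Proof.
have [->|v0] := eqVneq v 0; first by rewrite linear0l.
exact/ltW/neq0_dnorm_gt0.
Qed.

(** The two bounds hold at the centre because the metric induces an equivalent norm,
    and persist nearby because the metric read in the chart is continuous for the
    operator norm. *)
Lemma metric_bounds c p : chart_at S p c -> exists a b d : R,
  [/\ 0 < a, 0 < b, 0 < d, forall x, `|x - c p| < d -> chart_rng c x &
    forall q, chart_dom c q -> `|c q - c p| < d -> forall w : H,
      a * `|w| <= metric_norm (dchart_inv (S := S) q c w) <= b * `|w|].
Proof.
move=> [Sc cp]; have [G G_smooth GE] := metric_smooth g Sc.
have Grng : chart_rng c (c p) by exists p.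
have Gc : {for c p, continuous G} by exact: (G_smooth 0%N).
have pcp : chart_at S (chart_inv c (c p)) c by rewrite chart_funK.
have [a [b [a0 b0 ab]]] := metric_equiv g pcp.
have Ga w : (a * `|w|) ^+ 2 <= G (c p) w w.
  rewrite GE //; have /andP[+ _] := ab (dchart_inv _ c w).
  rewrite dchart_invK // => aw.
  rewrite -[leRHS]sqr_sqrtr ?metric_ge0 //.
  by rewrite ler_sqr ?nnegrE ?sqrtr_ge0 // mulr_ge0 // ltW.
have Gw x w : `|G x w w| <= `|G x| * `|w| ^+ 2.
  rewrite expr2 mulrA; apply: le_trans (opnorm_bound (G x w) _) _.
  rewrite ler_wpM2r //; exact: (opnorm_bound (G x) w).
have a2 : 0 < a ^+ 2 * (3 / 4) by rewrite mulr_gt0 ?exprn_gt0 // divr_gt0.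
have [d d0 dP] : exists2 d, 0 < d & forall x, `|x - c p| < d ->
    chart_rng c x /\ `|G (c p) - G x| < a ^+ 2 * (3 / 4).
  have Gd : \forall x \near c p, `|G (c p) - G x| < a ^+ 2 * (3 / 4).
    by move/cvgrPdist_lt : Gc => /(_ _ a2).
  have /nbhs_ballP[d /= d0 dP] : nbhs (c p)
      (chart_rng c `&` [set x | `|G (c p) - G x| < a ^+ 2 * (3 / 4)]).
    by apply: filterI => //; exact: chart_rng_nbhs.
  by exists d => // x xd; apply: dP; rewrite -ball_normE /= distrC.
pose b' := Num.sqrt (`|G (c p)| + a ^+ 2).
exists (a / 2), b', d; split=> //.
- by rewrite divr_gt0.
- by rewrite sqrtr_gt0 ltr_wpDl // exprn_gt0.
- by move=> x /dP[].
move=> q cq /dP[rq Gq] w.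
have := GE _ rq w w; rewrite chart_funK // => GqE.
rewrite /metric_norm -GqE.
have /ler_normlP[Gq1 Gq2] := Gw (c q) w.
have : `|G (c p) w w - G (c q) w w| <= a ^+ 2 * (3 / 4) * `|w| ^+ 2.
  rewrite -bop_subE -bop_subE.
  rewrite expr2 mulrA; apply: le_trans (opnorm_bound ((G (c p) - G (c q)) w) _) _.
  rewrite ler_wpM2r //; apply: le_trans (opnorm_bound (G (c p) - G (c q)) _) _.
  by rewrite ler_wpM2r // ltW.
move=> /ler_normlP[Gd1 Gd2].
have lower : (a / 2 * `|w|) ^+ 2 <= G (c q) w w.
  have -> : (a / 2 * `|w|) ^+ 2 = (a * `|w|) ^+ 2 - a ^+ 2 * (3 / 4) * `|w| ^+ 2 by field.
  move: (Ga w) Gd1 Gd2; move: (G (c p) w w) (G (c q) w w) ((a * `|w|) ^+ 2) (a ^+ 2 * _ * _).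
  by move=> *; lra.
apply/andP; split.
  rewrite -[leLHS]ger0_norm ?mulr_ge0 ?divr_ge0 ?(ltW a0) // -sqrtr_sqr.
  by rewrite ler_sqrt ?(le_trans _ lower) ?sqr_ge0.
rewrite -[`|w|]normr_id -sqrtr_sqr -sqrtrM ?addr_ge0 ?sqr_ge0 //.
rewrite ler_sqrt ?mulr_ge0 ?addr_ge0 ?sqr_ge0 //.
rewrite mulrDl.
have /ler_normlP[_ Gp] := Gw (c p) w.
have : a ^+ 2 * (3 / 4) * `|w| ^+ 2 <= a ^+ 2 * `|w| ^+ 2.
  by rewrite ler_wpM2r ?sqr_ge0 // ler_piMr ?sqr_ge0 // ler_pdivrMr // mul1r ler_nat.
move: Gp Gd1 Gd2.
move: (G (c p) w w) (G (c q) w w) (a ^+ 2 * `|w| ^+ 2) (a ^+ 2 * _ * _) (`|G _| * _).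
by move=> *; lra.
Qed.

End MetricBounds.

(** * Small chart balls are closed in the manifold *)

Section SeparatedBall.
Context {R : realType} {M : topologicalType} {H : completeNormedModType R}.
Context (S : @smooth_structure R M H) (B : H -> H -> R).
Hypothesis BC : forall u v, B u v = B v u.
Hypothesis Blin : forall a u v w, B (a *: u + v) w = a * B u w + B v w.
Hypothesis B_norm : forall u, `|u| ^+ 2 = B u u.
Hypothesis M_hausdorff : hausdorff_space M.

(** The Lipschitz bound makes the values Cauchy as [t] is approached. *)
Lemma lipschitz_left_cvg (u : R -> H) (K t : R) : 0 < t ->
  (forall s s', 0 <= s -> s <= s' -> s' < t -> `|u s' - u s| <= K * (s' - s)) ->
  cvg (u @ t^'-).
Proof.
move=> t0 uK; apply: cauchy_cvg; apply: cauchy_exP => e e0.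
have K1 : 0 < `|K| + 1 by rewrite ltr_wpDl.
pose s := Num.max 0 (t - e / (`|K| + 1)).
have s0 : 0 <= s by rewrite le_max lexx.
have st : s < t by rewrite gt_max t0 ltrBlDr ltrDl divr_gt0.
exists (u s).
apply: filterS2 (nbhs_left_lt t) (nbhs_left_gt st) => s' s't ss'.
rewrite -ball_normE /= distrC; apply: le_lt_trans (uK s s' s0 (ltW ss') s't) _.
apply: (@le_lt_trans _ _ (`|K| * (s' - s))).
  by rewrite ler_wpM2r ?ler_norm // subr_ge0 ltW.
apply: (@lt_le_trans _ _ ((`|K| + 1) * (s' - s))).
  by rewrite ltr_pM2r ?ltrDl // subr_gt0.
rewrite mulrC -ler_pdivlMr //.
have : t - e / (`|K| + 1) <= s by rewrite le_max lexx orbT.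
by move: (e / _) => x; lra.
Qed.

(** Suppose that points [q'] of a small chart ball come arbitrarily close to a point
    [q] outside the domain of [phi]. In a chart [c] at [q], join [q'] to [q] by a
    straight segment. As long as this path stays in the domain of [phi], comparing
    both charts with the metric bounds its speed read in [phi] by a constant times
    [|c q - c q'|], so it does not leave a slightly larger ball; its position in
    [phi] thus converges, and as the manifold is Hausdorff the limit is the
    position of the path. By real induction the path never leaves the domain, so
    [q] belongs to it. *)
Lemma separated_ball_exists (g : riemannian_metric S) p phi :
  chart_at S p phi -> exists2 r : R, 0 < r & separated_ball phi (phi p) r.
Proof.
move=> pphi; have [Sphi phip] := pphi.
have [a0 [b0 [d0 [a00 b00 d00 d0_rng phi_bd]]]] := metric_bounds g pphi.
exists (d0 / 2); first by rewrite divr_gt0.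
move=> q nphiq.
have [c Sc cq] := atlas_cover S q.
have [a1 [b1 [d1 [a10 b10 d10 d1_rng c_bd]]]] := metric_bounds g (conj Sc cq).
pose L := b1 / a0.
have L0 : 0 < L by rewrite divr_gt0.
have delta0 : 0 < Num.min d1 (d0 / 2 / L) by rewrite lt_min d10 !divr_gt0.
have q_near : \forall q' \near q, `|c q' - c q| < Num.min d1 (d0 / 2 / L).
  apply: (@near_chart _ _ _ c q (fun x => `|x - c q| < Num.min d1 (d0 / 2 / L))) => //.
  by apply/nbhs_ballP; exists (Num.min d1 (d0 / 2 / L)) => //= x;
    rewrite -ball_normE /= distrC.
apply: filterS2 (chart_dom_nbhs cq) q_near => q' cq' + phiq'.
rewrite lt_min => /andP[q'd1 q'L]; rewrite leNgt; apply/negP => q'd0.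
apply: nphiq.
pose w := c q - c q'.
have w_norm : `|w| = `|c q' - c q| by rewrite distrC.
pose K := L * `|w|.
have Kd : K < d0 / 2 by rewrite /K w_norm mulrC -ltr_pdivlMr.
pose sig (t : R) := c q' + t *: w.
have sig_near (t : R) : 0 <= t <= 1 -> `|sig t - c q| < d1.
  move=> /andP[t0 t1].
  have -> : sig t - c q = (1 - t) *: (c q' - c q).
    rewrite /sig /w scalerBl scale1r -(opprB (c q') (c q)) scalerN.
    by rewrite addrAC.
  rewrite normrZ ger0_norm ?subr_ge0 //; apply: le_lt_trans q'd1.
  by rewrite ler_piMl // gerBl.
pose m t := chart_inv c (sig t).
have m_dom (t : R) : 0 <= t <= 1 -> chart_dom c (m t) /\ c (m t) = sig t.
  move=> /sig_near/d1_rng[q'' cq'' E].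
  by rewrite /m -E chart_funK.
pose u t := phi (m t).
pose good t := chart_dom phi (m t) /\ `|u t - phi p| < d0.
have sig_cont : continuous sig.
  by move=> t; apply: cvgD; [exact: cvg_cst|apply: cvgZl].
have m_cont (t : R) : 0 <= t <= 1 -> m @ t --> m t.
  move=> t01; apply: (cvg_comp sig (chart_inv c) (sig_cont t)).
  by apply: chart_inv_continuous; exact/d1_rng/sig_near.
have good_open (t : R) : 0 <= t <= 1 -> good t -> \forall s \near t, good s.
  move=> t01 [phim um].
  have N1 : nbhs (m t) (chart_dom phi) by exact: chart_dom_nbhs.
  have N2 : \forall q'' \near m t, `|phi q'' - phi p| < d0.
    apply: (@near_chart _ _ _ phi (m t) (fun x => `|x - phi p| < d0)) => //.
    have r0 : 0 < d0 - `|u t - phi p| by rewrite subr_gt0.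
    apply/nbhs_ballP; exists (d0 - `|u t - phi p|) => //= x.
    rewrite -ball_normE /= distrC ltrBrDr; apply: le_lt_trans.
    exact: ler_distD.
  have E1 : \forall s \near t, chart_dom phi (m s) by exact: m_cont t t01 _ N1.
  have E2 : \forall s \near t, `|u s - phi p| < d0 by exact: m_cont t t01 _ N2.
  by apply: filterS2 E1 E2 => s.
have u_derive (t : R) : 0 <= t <= 1 -> good t ->
    derivable u t 1 /\ `|'D_1 u t| <= K.
  move=> t01 [phim um]; have [cm cmE] := m_dom t t01.
  have dT : differentiable (phi \o chart_inv c) (sig t).
    by rewrite -cmE; exact: (is_diff_transition (conj Sc cm) (conj Sphi phim)).
  have dsig : is_diff (t : R^o) sig ( *:%R^~ w).
    have := is_diffD (is_diff_cst (c q') (t : R^o)) (is_diff_scalel t w).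
    by rewrite add0r.
  have dTd : is_diff (sig t) (phi \o chart_inv c) ('d (phi \o chart_inv c) (sig t)).
    by split.
  have [du duE] := is_diff_comp dsig dTd.
  have -> : 'D_1 u t = 'd (phi \o chart_inv c) (sig t) w.
    by rewrite (deriveE _ du) duE /= scale1r.
  split; first exact/derivable1_diffP.
  set z := dchart_inv (S := S) (m t) c w.
  have zE : dchart phi z = 'd (phi \o chart_inv c) (sig t) w.
    by rewrite /z dchart_invE // cmE.
  rewrite -zE /K /L mulrAC ler_pdivlMr // mulrC.
  have /andP[z1 _] := phi_bd _ phim um (dchart phi z).
  rewrite dchartK // in z1; apply: le_trans z1 _.
  have cmd : `|c (m t) - c q| < d1 by rewrite cmE; exact: sig_near.
  by have /andP[] := c_bd _ cm cmd w.
have u_lip (s s' : R) : 0 <= s -> s <= s' -> s' <= 1 -> (forall t, s <= t <= s' -> good t) ->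
    `|u s' - u s| <= K * (s' - s).
  move=> s0 ss' s'1 gd.
  have in01 (t : R) : s <= t <= s' -> 0 <= t <= 1.
    by move=> /andP[st ts']; rewrite (le_trans s0) // (le_trans ts').
  by apply: (mean_value_inequality BC Blin B_norm ss') => t tss;
    case: (u_derive t (in01 t tss) (gd t tss)).
have m0 : m 0 = q' by rewrite /m /sig scale0r addr0 chart_funK.
have m1 : m 1 = q by rewrite /m /sig scale1r /w addrC subrK chart_funK.
have good0 : good 0.
  split; rewrite ?/u m0 //; apply: lt_le_trans q'd0 _.
  by rewrite ler_pdivrMr // ler_peMr ?ler1n // ltW.
suff : good 1 by rewrite /good m1 => -[].
(* the path cannot leave the ball: closedness of [good] from the left *)
apply: (@real_induction _ good good0 good_open) => //; last by rewrite ler01 lexx.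
move=> t /andP[t0 t1] gd.
have lip (s s' : R) : 0 <= s -> s <= s' -> s' < t -> `|u s' - u s| <= K * (s' - s).
  move=> s0 ss' s't; apply: u_lip => //; first by rewrite (le_trans (ltW s't)).
  by move=> x /andP[sx xs']; apply: gd; rewrite (le_trans s0 sx) (le_lt_trans xs').
have /cvg_ex[y uy] := lipschitz_left_cvg t0 lip.
have y_near : `|y - phi p| < d0.
  have yle : `|y - phi p| <= `|u 0 - phi p| + K.
    have cn : (fun s => `|u s - phi p|) @ t^'- --> `|y - phi p|.
      by apply: cvg_norm; apply: cvgB => //; exact: cvg_cst.
    rewrite -(cvg_lim _ cn) //; apply: limr_le; first by apply/cvg_ex; exists `|y - phi p|.
    apply: filterS2 (nbhs_left_lt t) (nbhs_left_gt t0) => s st s0.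
    apply: le_trans (ler_distD (u 0) _ _) _; rewrite addrC lerD2l.
    apply: le_trans (lip 0 s _ (ltW s0) st) _ => //.
    rewrite subr0 ler_piMr //; first by rewrite mulr_ge0 // ltW.
    by rewrite (le_trans (ltW st)).
  apply: le_lt_trans yle _; rewrite {1}/u m0; move: Kd q'd0; clear; lra.
have [q'' phiq'' yE] := d0_rng _ y_near.
have inv_y : {for y, continuous (chart_inv phi)}.
  by apply: chart_inv_continuous; exists q''.
have my : m @ t^'- --> q''.
  have : (chart_inv phi \o u) @ t^'- --> chart_inv phi y.
    exact: (cvg_comp u (chart_inv phi) uy inv_y).
  rewrite -yE chart_funK //; apply: cvg_trans; apply: near_eq_cvg.
  apply: filterS2 (nbhs_left_lt t) (nbhs_left_gt t0) => s st s0.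
  by rewrite /= /u chart_funK //; case: (gd s) => //; rewrite (ltW s0).
have mt : m @ t^'- --> m t.
  by apply: cvg_at_left_filter; apply: m_cont; rewrite (ltW t0).
have mtE : m t = q'' := cvg_unique M_hausdorff mt my.
by rewrite /good /u mtE yE.
Qed.
End SeparatedBall.

(** * Riemannian distance and straight segments of a chart *)

Section ChartDistance.
Context {R : realType} {M : topologicalType} {H : normedModType R}.
Context (S : @smooth_structure R M H) (g : riemannian_metric S).

(** The integral of a nonnegative function is the supremum of the integrals of the
    simple functions below it, hence monotone in the function. *)
Lemma ge0_integral_le_cst (D : set R) (f : R -> \bar R) (k : \bar R) :
  measurable D -> (forall x, D x -> (0 <= f x <= k)%E) ->
  (\int[@lebesgue_measure R]_(x in D) f x <= k * @lebesgue_measure R D)%E.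
Proof.
move=> mD fk; have [D0|/set0P[x0 Dx0]] := eqVneq D set0.
  by rewrite D0 integral_set0 measure0 mule0.
have k0 : (0 <= k)%E by have /andP[a b] := fk _ Dx0; exact: le_trans b.
rewrite -integral_cst // [leLHS]ge0_integralE; last by move=> x /fk/andP[].
rewrite [leRHS]ge0_integralE; last by [].
apply: ereal_sup_le => _ [h /= hf <-].
exists h => // x; apply: le_trans (hf x) _.
by apply: lee_restrict => y /fk/andP[].
Qed.

(** Balls are convex, so the metric bound applies all along the straight segment of
    the chart joining the two points, and it bounds the length of that path. *)
Lemma riemannian_distance_segment_le phi (x0 w x : H) (b d : R) :
  atlas S phi -> (forall x, `|x - x0| < d -> chart_rng phi x) ->
  (forall q, chart_dom phi q -> `|phi q - x0| < d -> forall w : H,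
     metric_norm g (dchart_inv (S := S) q phi w) <= b * `|w|) ->
  `|x - x0| < d -> `|x + w - x0| < d ->
  (riemannian_distance g (chart_inv phi x) (chart_inv phi (x + w)%R) <= (b * `|w|)%:E)%E.
Proof.
move=> Sphi rng_d bd xd xwd.
pose sig (t : R) := x + t *: w.
have sig_cont : continuous sig.
  by move=> t; apply: cvgD; [exact: cvg_cst|apply: cvgZl].
have sig_d (t : R) : t \in `[0, 1]%R -> `|sig t - x0| < d.
  rewrite in_itv /= => /andP[t0 t1].
  have -> : sig t - x0 = (1 - t) *: (x - x0) + t *: (x + w - x0).
    rewrite /sig scalerBl scale1r (addrAC x w) (scalerDr _ (x - x0)).
    by rewrite addrA subrK addrAC.
  apply: le_lt_trans (ler_normD _ _) _.
  rewrite !normrZ ger0_norm ?subr_ge0 // (ger0_norm t0).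
  have [->|tn0] := eqVneq t 0; first by rewrite subr0 mul1r mul0r addr0.
  have tp : 0 < t by rewrite lt_def tn0.
  have : t * `|x + w - x0| < t * d by rewrite ltr_pM2l.
  have : (1 - t) * `|x - x0| <= (1 - t) * d by rewrite ler_wpM2l ?subr_ge0 // ltW.
  by move: (_ * `|_|) (_ * `|_|) => ? ?; lra.
pose gam (t : R) := chart_inv phi (sig t).
have gam_dom (t : R) : t \in `[0, 1]%R -> chart_dom phi (gam t) /\ phi (gam t) = sig t.
  by move=> /sig_d/rng_d[q phiq E]; rewrite /gam -E chart_funK.
have gam_cont (t : R) : t \in `[0, 1]%R -> gam @ t --> gam t.
  move=> t01; apply: (cvg_comp sig (chart_inv phi) (sig_cont t)).
  by apply: chart_inv_continuous; exact/rng_d/sig_d.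
pose gam' t : tangent S (gam t) := dchart_inv (S := S) (gam t) phi w.
have gamC1 : C1_path 0 1 gam'.
  split.
    apply: continuous_in_subspaceT => t; rewrite inE => t01; exact: gam_cont.
  move=> c t Sc t01 ct; have [phit phitE] := gam_dom t t01.
  have [D DP cD] := atlas_transition Sphi Sc 1%N.
  have At : (phi @` (chart_dom phi `&` chart_dom c)) (sig t).
    by exists (gam t).
  have gam'E (s : R) : s \in `[0, 1]%R -> chart_dom c (gam s) ->
      dchart c (gam' s) = D (sig s) w.
    move=> s01 cs; have [phis phisE] := gam_dom s s01.
    rewrite /gam' (dchart_invE _ (conj Sphi phis) (conj Sc cs)) phisE.
    have As : (phi @` (chart_dom phi `&` chart_dom c)) (sig s).
      by exists (gam s).
    by have [_ ->] := DP _ As.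
  rewrite gam'E //; split.
    apply: cvg_trans (cvg_app _ (cvg_within _)) _.
    have [DT _] := DP _ At.
    have /is_diffP Tdiff := DP _ At.
    apply/cvgrPdist_le => e e0.
    have e'0 : 0 < e / (`|w| + 1) by rewrite divr_gt0 // ltr_wpDl.
    have hs : (s - t) *: w @[s --> t] --> (t - t) *: w.
      by apply: cvgZl; apply: cvgB => //; exact: cvg_cst.
    rewrite subrr scale0r in hs.
    have near_h : \forall s \near t, `|(c \o chart_inv phi) ((s - t) *: w + sig t) -
        (c \o chart_inv phi) (sig t) - D (sig t) ((s - t) *: w)|
        <= e / (`|w| + 1) * `|(s - t) *: w| by exact: hs _ (Tdiff _ e'0).
    rewrite /dnbhs near_withinE; apply: filterS near_h => s + st.
    have sigE : (s - t) *: w + sig t = sig s.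
      by rewrite /sig addrCA -scalerDl subrK.
    rewrite sigE /= -/(gam s) -/(gam t) normrZ linearZ => le_s.
    have st0 : 0 < `|s - t| by rewrite normr_gt0 subr_eq0.
    rewrite -(ler_pM2l st0) -normrZ scalerBr scalerA divff ?subr_eq0 // scale1r.
    rewrite distrC; apply: le_trans le_s _.
    rewrite mulrCA ler_wpM2l // mulrAC ler_pdivrMr ?ltr_wpDl //.
    by rewrite ler_wpM2l ?(ltW e0) // lerDl.
  have D_cont : (fun s => D (sig s) w) @ t --> D (sig t) w.
    by apply: cvg_bop_eval; exact: (cvg_comp sig D (sig_cont t) (cD _ At)).
  apply: cvg_trans (cvg_trans (cvg_app _ (cvg_within _)) D_cont).
  apply: near_eq_cvg; rewrite near_withinE.
  have c_near : \forall s \near t, chart_dom c (gam s).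
    by exact: gam_cont t t01 _ (chart_dom_nbhs ct).
  by apply: filterS c_near => s cs s01; rewrite gam'E.
apply: (@le_trans _ _ (path_length g 0 1 gam')).
  apply: ereal_inf_lbound; exists 0, 1, gam, gam'; split=> //.
    by rewrite /gam /sig scale0r addr0.
  by rewrite /gam /sig scale1r.
rewrite /path_length; apply: le_trans (@ge0_integral_le_cst _ _ (b * `|w|)%:E _ _) _ => //.
  move=> t t01; rewrite !lee_fin sqrtr_ge0 /=.
  have [phit phitE] := gam_dom t t01.
  by apply: bd => //; rewrite phitE; exact: sig_d.
rewrite lebesgue_measure_itv /= lte_fin ltr01 oppr0 adde0 mule1 //.
Qed.
End ChartDistance.

(** * Reading the data of the theorem in a chart *)

Section ChartReading.
Context {R : realType} {M : topologicalType} {H : normedModType R}.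
Context (S : @smooth_structure R M H).

Lemma riemannian_uniformly_continuous_chart (g : riemannian_metric S) (f : M -> R) p phi :
  riemannian_uniformly_continuous g f -> chart_at S p phi ->
  exists2 d : R, 0 < d & (forall x, `|x - phi p| < d -> chart_rng phi x) /\
    forall s : R, 0 < s -> exists2 r : R, 0 < r & forall x y, `|x - phi p| < d ->
      `|y - phi p| < d -> `|x - y| < r ->
      `|f (chart_inv phi x) - f (chart_inv phi y)| < s.
Proof.
move=> f_unif pphi; have [Sphi phip] := pphi.
have [a [b [d [a0 b0 d0 d_rng phi_bd]]]] := metric_bounds g pphi.
exists d => //; split=> // s s0.
have [k k0 f_k] := f_unif s s0.
exists (k / b); first by rewrite divr_gt0.
move=> x y xd yd xy; apply: f_k.
have phi_ub q : chart_dom phi q -> `|phi q - phi p| < d -> forall w : H,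
    metric_norm g (dchart_inv (S := S) q phi w) <= b * `|w|.
  by move=> phiq qd w; have /andP[] := phi_bd q phiq qd w.
have yE : x + (y - x) = y by rewrite addrC subrK.
have := riemannian_distance_segment_le Sphi d_rng phi_ub xd (w := y - x).
rewrite yE => /(_ yd) /le_lt_trans; apply.
by rewrite lte_fin distrC mulrC -ltr_pdivlMr.
Qed.

(** Subtracting [psi] keeps lower semicontinuity, as [psi] is continuous. *)
Lemma chart_lower_semicontinuous (f psi : M -> R) phi x t :
  lower_semicontinuous (EFin \o f) -> atlas S phi -> C1_function S psi ->
  chart_rng phi x -> t < f (chart_inv phi x) - psi (chart_inv phi x) ->
  \forall y \near x, t < f (chart_inv phi y) - psi (chart_inv phi y).
Proof.
move=> f_lsc Sphi psi1 [q phiq <-]; rewrite chart_funK // => tq.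
pose s := (f q - psi q - t) / 2.
have s0 : 0 < s by rewrite divr_gt0 // subr_gt0.
have [] := f_lsc q (f q - s); first by rewrite lte_fin gtrBl.
move=> V qV Vf.
have psi_cont : psi (chart_inv phi y) @[y --> phi q] --> psi (chart_inv phi (phi q)).
  have [D DP _] := psi1 phi Sphi.
  have [dpsi _] := DP (phi q) (ex_intro2 _ _ q phiq erefl).
  exact: differentiable_continuous dpsi.
have near1 : \forall y \near phi q, `|psi q - psi (chart_inv phi y)| < s.
  by move/cvgrPdist_lt: psi_cont => /(_ s s0); rewrite chart_funK.
apply: filterS2 (near_chart_inv phiq qV) near1 => y /Vf; rewrite lte_fin.
move=> fy; rewrite distrC => /ltr_normlW py.
have : t = f q - psi q - 2 * s by rewrite /s; field.
by move: fy py; lra.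
Qed.

Lemma comp_dchartD (p : M) phi (l l' : bop H R^o) :
  comp_dchart (S := S) p phi (l + l') = comp_dchart p phi l + comp_dchart p phi l'.
Proof. exact/val_inj/funext. Qed.

Lemma comp_dchart_invK (p : M) phi (z : cotangent S p) : chart_at S p phi ->
  comp_dchart p phi (comp_dchart_inv phi z) = z.
Proof.
move=> pphi; apply/val_inj/funext => v.
exact: (congr1 (fun u => z u) (dchartK pphi v)).
Qed.

Lemma comp_dchartK (p : M) phi (l : bop H R^o) : chart_at S p phi ->
  comp_dchart_inv phi (comp_dchart (S := S) p phi l) = l.
Proof.
move=> pphi; apply/val_inj/funext => v.
exact: (congr1 (fun u => l u) (dchart_invK pphi v)).
Qed.

(** The bundle chart of [phi] turns a neighbourhood of the covector into a product of
    balls, in which the base point and the covector can be moved independently. *)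
Lemma cotangent_nbhs_chart (p : M) phi (z : cotangent S p) V :
  chart_at S p phi -> nbhs (CotangentPoint z) V ->
  exists2 e : R, 0 < e & forall x (l : bop H R^o), `|x - phi p| < e ->
    `|l - comp_dchart_inv phi z| < e ->
    V (CotangentPoint (comp_dchart (S := S) (chart_inv phi x) phi l)).
Proof.
move=> pphi; have [Sphi phip] := pphi.
rewrite nbhsE => -[N [oO Oz] OV].
have {}oO : cotangent_open N by exact: oO.
have Yz : nbhs (phi p, comp_dchart_inv phi z : bop H R^o)
    [set y : H * bop H R^o | chart_rng phi y.1 /\
      N (CotangentPoint (comp_dchart (S := S) (chart_inv phi y.1) phi y.2))].
  apply: open_nbhs_nbhs; split; first exact: oO.
  split; first by exists p.
  by rewrite /= chart_funK // comp_dchart_invK.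
have /nbhs_ballP[e /= e0 eY] := Yz.
exists e => // x l xe le; apply: OV.
have [] // : [set y : H * bop H R^o | chart_rng phi y.1 /\
    N (CotangentPoint (comp_dchart (S := S) (chart_inv phi y.1) phi y.2))] (x, l).
by apply: eY; split; rewrite -ball_normE /= distrC.
Qed.

Lemma is_differential_comp_dchart_inv (u : M -> R) p phi (z : cotangent S p)
    (L : bop H R^o) :
  chart_at S p phi -> is_differential u z ->
  is_diff (phi p) (u \o chart_inv phi : H -> R^o) L -> comp_dchart_inv phi z = L.
Proof.
move=> pphi uz [_ uL]; apply/val_inj/funext => w.
by rewrite -[LHS]/(z (dchart_inv p phi w)) (uz phi pphi) dchart_invK // uL.
Qed.

End ChartReading.

(** * The fuzzy sum rule on a manifold *)

Theorem theorem4p13 (R : realType)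
  (H : completeNormedModType R) (dotH : {dot H for idfun})
  (norm_dotH : forall x : H, `|x| = Num.sqrt (dotH x x))
  (M : topologicalType) (M_hausdorff : hausdorff_space M)
  (S : @smooth_structure R M H) (g : riemannian_metric S)
  (f1 f2 : M -> R)
  (f1_lsc : lower_semicontinuous (EFin \o f1))
  (f2_unif : riemannian_uniformly_continuous g f2)
  (p : M) (phi : @chart R M H) (phi_atlas : atlas S phi)
  (phi_p : chart_dom phi p)
  (zeta : cotangent S p) (zeta_sub : subdifferential (f1 \+ f2) zeta)
  (e : R) (e_gt0 : 0 < e)
  (V : set (cotangent_bundle S)) (V_nbhs : nbhs (CotangentPoint zeta) V) :
  exists (p1 p2 : M) (zeta1 : cotangent S p1) (zeta2 : cotangent S p2),
    [/\ chart_dom phi p1 /\ chart_dom phi p2,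
        subdifferential f1 zeta1 /\ subdifferential f2 zeta2,
        V (CotangentPoint (comp_dchart p1 phi (comp_dchart_inv phi zeta1) +
                           comp_dchart p1 phi (comp_dchart_inv phi zeta2))),
        V (CotangentPoint (comp_dchart p2 phi (comp_dchart_inv phi zeta1) +
                           comp_dchart p2 phi (comp_dchart_inv phi zeta2))) &
        `|f1 p1 - f1 p| < e /\ `|f2 p2 - f2 p| < e].
Proof.
have pphi : chart_at S p phi by [].
have BC u v : dotH u v = dotH v u by rewrite (hermC dotH) expr0 mul1r.
have Blin a u v w : dotH (a *: u + v) w = a * dotH u w + dotH v w.
  exact: linearPl.
have B_norm u : `|u| ^+ 2 = dotH u u.
  rewrite norm_dotH sqr_sqrtr //.
  have [->|u0] := eqVneq u 0; first by rewrite linear0l.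
  exact/ltW/neq0_dnorm_gt0.
(* the ball in which bumps can be extended by zero *)
have [r r0 sep] := separated_ball_exists BC Blin B_norm M_hausdorff g pphi.
have [rho rho0 [rho_rng f2_chart]] := riemannian_uniformly_continuous_chart f2_unif pphi.
have [eV eV0 eVP] := cotangent_nbhs_chart pphi V_nbhs.
have [psi [psi1 psi_min psi_zeta]] := zeta_sub.
have [D DP D_cont] := psi1 phi phi_atlas.
have zetaE : comp_dchart_inv phi zeta = D (phi p).
  by apply: (is_differential_comp_dchart_inv pphi psi_zeta); apply: DP; exists p.
rewrite zetaE in eVP.
have psi_cont : psi (chart_inv phi x) @[x --> phi p] --> psi (chart_inv phi (phi p)).
  have [dpsi _] := DP (phi p) (ex_intro2 _ _ p phi_p erefl).
  exact: differentiable_continuous dpsi.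
have eV2 : 0 < eV / 2 by rewrite divr_gt0.
have e2 : 0 < e / 2 by rewrite divr_gt0.
have /nbhs_ballP[d /= d0 dP] : \forall x \near phi p,
    [/\ f1 p + f2 p - psi p <=
          f1 (chart_inv phi x) + f2 (chart_inv phi x) - psi (chart_inv phi x),
        `|D x - D (phi p)| < eV / 2 & `|psi (chart_inv phi x) - psi p| < e / 2].
  have n2 : \forall x \near phi p, `|D (phi p) - D x| < eV / 2.
    have Dc : {for phi p, continuous D} by apply: D_cont; exists p.
    by move/cvgrPdist_lt: Dc => /(_ _ eV2).
  have n3 : \forall x \near phi p, `|psi p - psi (chart_inv phi x)| < e / 2.
    by move/cvgrPdist_lt: psi_cont => /(_ _ e2); rewrite chart_funK.
  apply: filterS3 (near_chart_inv phi_p psi_min) n2 n3 => x x1 x2 x3.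
  by rewrite distrC (distrC (psi _)).
have [s [s0 srho sd sr [seV se]]] : exists s, [/\ 0 < s, s <= rho, s <= d, s <= r &
    s <= eV / 2 /\ s <= e / 2].
  exists (Num.min (Num.min rho d) (Num.min r (Num.min (eV / 2) (e / 2)))).
  by rewrite !lt_min !ge_min !lexx !orbT rho0 d0 r0 eV2 e2.
(* the test function [psi] is subtracted from the lower semicontinuous summand, so
   that the sum [F1 + F2] itself has a local minimum at [phi p] *)
pose F1 x := f1 (chart_inv phi x) - psi (chart_inv phi x).
pose F2 x := f2 (chart_inv phi x).
have near_p x : `|x - phi p| < s ->
    [/\ chart_dom phi (chart_inv phi x), phi (chart_inv phi x) = x &
      `|phi (chart_inv phi x) - phi p| < r].
  move=> xs; have [q phiq qE] := rho_rng _ (lt_le_trans xs srho).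
  by rewrite -qE chart_funK // qE; split=> //; exact: lt_le_trans sr.
have [|||x1 [x2 [a1 [a2 [Q [[x1s x2s] [F1s F2s] a_small prox1 prox2]]]]]] :=
  @fuzzy_sum_rule R H dotH BC Blin B_norm (phi p) s F1 F2 s s0 _ _ _ s0.
- move=> x t xs tx; apply: (chart_lower_semicontinuous f1_lsc phi_atlas psi1 _ tx).
  by apply: rho_rng; exact: lt_le_trans srho.
- move=> k k0; have [k' k'0 kP] := f2_chart k k0.
  by exists k' => // x y xs ys; apply: kP; exact: lt_le_trans srho.
- move=> x xs; have [|x_min _ _] := dP x.
    by rewrite -ball_normE /= distrC (lt_le_trans xs).
  by move: x_min; rewrite /F1 /F2 chart_funK //; lra.
have [phix1 x1E x1r] := near_p _ x1s; have [phix2 x2E x2r] := near_p _ x2s.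
set p1 := chart_inv phi x1 in phix1 x1E x1r.
set p2 := chart_inv phi x2 in phix2 x2E x2r.
have [|_ Dx1 psix1] := dP x1; first by rewrite -ball_normE /= distrC (lt_le_trans x1s).
(* subtracting [psi] has shifted the first covector by the differential of [psi] *)
pose l1 := riesz BC Blin B_norm a1 + D x1.
pose l2 := riesz BC Blin B_norm a2 + 0.
have p1phi : chart_at S p1 phi by [].
have p2phi : chart_at S p2 phi by [].
have x_eV x : `|x - phi p| < s -> `|x - phi p| < eV.
  move=> xs; apply: lt_le_trans xs (le_trans seV _).
  by rewrite ler_pdivrMr // ler_peMr ?ler1n // ltW.
have l_eV : `|l1 + l2 - D (phi p)| < eV.
  have -> : l1 + l2 - D (phi p) = riesz BC Blin B_norm (a1 + a2) + (D x1 - D (phi p)).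
    by rewrite /l1 /l2 addr0 rieszD (addrAC _ (D x1)) addrA.
  apply: le_lt_trans (ler_normD _ _) _.
  have := riesz_norm BC Blin B_norm (a1 + a2).
  by move: a_small Dx1 seV; clear; lra.
exists p1, p2, (comp_dchart p1 phi l1), (comp_dchart p2 phi l2).
rewrite !comp_dchartK // -!comp_dchartD; split=> //.
- split.
    apply: (proximal_subdifferential BC Blin B_norm (phi := phi) (x0 := phi p) (r := r)
      (psi := psi) (Q := Q)) => //.
      by rewrite x1E; apply: DP; rewrite -x1E; exists p1.
    by rewrite x1E; exact: prox1.
  apply: (proximal_subdifferential BC Blin B_norm (phi := phi) (x0 := phi p) (r := r)
      (psi := fun=> 0) (Q := Q)) => //.
    exact: C1_function_cst.
    exact: is_diff_cst.
  by rewrite x2E subr0; apply: filterS prox2 => x; rewrite /F2 subr0.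
- exact: eVP (x_eV _ x1s) l_eV.
- exact: eVP (x_eV _ x2s) l_eV.
split.
  have -> : f1 p1 - f1 p = (F1 x1 - F1 (phi p)) + (psi p1 - psi p).
    by rewrite /F1 chart_funK // -/p1; ring.
  apply: le_lt_trans (ler_normD _ _) _.
  by move: F1s psix1 se; rewrite -/p1; clear; lra.
move: F2s; rewrite /F2 chart_funK // => /lt_le_trans; apply.
by apply: le_trans se _; rewrite ler_pdivrMr // ler_peMr ?ler1n // ltW.
Qed.
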